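(* Let $n\ge1$ and $\alpha\in(0,1)$. Let $E$ be a set with locally finite fractional Caccioppoli $\alpha$-perimeter in $\mathbb R^n$ and let $x\in\mathscr F^\alpha E$. If $F\in\mathrm{Tan}(E,x)$, then $F$ is a set of locally finite fractional Caccioppoli $\alpha$-perimeter in $\mathbb R^n$ such that $\nu^\alpha_F(y)=\nu^\alpha_E(x)$ for $|D^\alpha\chi_F|$-a.e. $y\in\mathscr F^\alpha F$.
   Context: For $\alpha\in(0,1)$ let $\mu_{n,\alpha}:=2^\alpha\pi^{-n/2}\,\Gamma\big(\tfrac{n+\alpha+1}{2}\big)/\Gamma\big(\tfrac{1-\alpha}{2}\big)$. For $\varphi\in C^\infty_c(\mathbb R^n;\mathbb R^n)$, $$\mathrm{div}^\alpha\varphi(x):=\mu_{n,\alpha}\int_{\mathbb R^n}\frac{(y-x)\cdot(\varphi(y)-\varphi(x))}{|y-x|^{n+\alpha+1}}\,dy\in L^1(\mathbb R^n)\cap L^\infty(\mathbb R^n).$$ For a measurable set $E\subset\mathbb R^n$ and $U\subset\mathbb R^n$ open, $|D^\alpha\chi_E|(U):=\sup\{\int_E\mathrm{div}^\alpha\varphi\,dx:\varphi\in C^\infty_c(U;\mathbb R^n),\ \|\varphi\|_{L^\infty}\le1\}$. $E$ has locally finite fractional Caccioppoli $\alpha$-perimeter in $\mathbb R^n$ if $|D^\alpha\chi_E|(U)<+\infty$ for every bounded open $U$. In that case there is a unique $\mathbb R^n$-valued Radon measure $D^\alpha\chi_E$ on $\mathbb R^n$ (finite on bounded sets), with total variation measure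 $|D^\alpha\chi_E|$, such that $\int_E\mathrm{div}^\alpha\varphi\,dx=-\int\varphi\cdot dD^\alpha\chi_E$ for all $\varphi\in C^\infty_c(\mathbb R^n;\mathbb R^n)$. The fractional reduced boundary $\mathscr F^\alpha E$ is the set of points $x\in\mathrm{supp}(D^\alpha\chi_E)$ such that the limit $\nu^\alpha_E(x):=\lim_{r\to0}\frac{D^\alpha\chi_E(B_r(x))}{|D^\alpha\chi_E|(B_r(x))}$ exists and belongs to $\mathbb S^{n-1}$; $\nu^\alpha_E:\mathscr F^\alpha E\to\mathbb S^{n-1}$ is the inner unit fractional normal. For $x\in\mathscr F^\alpha E$, $\mathrm{Tan}(E,x)$ is the set of all limit points, in the $L^1_{\mathrm{loc}}(\mathbb R^n)$-topology (convergence of characteristic functions), of the family $\big\{\tfrac{E-x}{r}:r>0\big\}$ as $r\to0$; that is, measurable sets $F$ such that $\chi_{(E-x)/r_k}\to\chi_F$ in $L^1_{\mathrm{loc}}(\mathbb R^n)$ for some sequence $r_k\to0^+$. *)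

(* Defs.v *)
From HB Require Import structures.
From mathcomp Require Import all_boot all_order all_algebra.
From mathcomp Require Import all_classical all_reals all_analysis.

Set Implicit Arguments.
Unset Strict Implicit.
Unset Printing Implicit Defensive.

Import Order.TTheory GRing.Theory Num.Theory.
Import numFieldNormedType.Exports.

Local Open Scope classical_set_scope.
Local Open Scope ring_scope.

(* As for [n.-tuple T] in the library, ['rV[T]_n] carries the product
   sigma-algebra, generated by the coordinate projections. For [T] the real
   line it is the Borel sigma-algebra of the topology of ['rV[R]_n]. *)
Definition measure_row_display : measure_display -> measure_display.
Proof. exact. Qed.

Section measurable_row.
Context {d} {T : sigmaRingType d}.
Variable n : nat.

Let coors : 'I_n -> 'rV[T]_n -> T := fun i v => v ord0 i.

Let row_set0 : g_sigma_preimage coors set0.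
Proof. exact: sigma_algebra0. Qed.

Let row_setC A : g_sigma_preimage coors A -> g_sigma_preimage coors (~` A).
Proof. exact: sigma_algebraC. Qed.

Let row_bigcup (F : _^nat) : (forall i, g_sigma_preimage coors (F i)) ->
  g_sigma_preimage coors (\bigcup_i (F i)).
Proof. exact: sigma_algebra_bigcup. Qed.

HB.instance Definition _ := @isMeasurable.Build (measure_row_display d)
  'rV[T]_n (g_sigma_preimage coors) row_set0 row_setC row_bigcup.

End measurable_row.

Lemma measurable_coord d (T : sigmaRingType d) n (i : 'I_n) :
  measurable_fun [set: 'rV[T]_n] (fun v : 'rV[T]_n => v ord0 i).
Proof.
move=> _ Y mY; rewrite setTI; apply: sub_sigma_algebra => /=.
rewrite -bigcup_seq/=; exists i => /=; first by rewrite mem_index_enum.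
by exists Y => //; rewrite setTI.
Qed.

Lemma measurable_fun_rowP d1 d2 (T1 : measurableType d1)
    (T2 : sigmaRingType d2) n (f : T1 -> 'rV[T2]_n) :
  (forall i, measurable_fun [set: T1] (fun x => f x ord0 i)) ->
  measurable_fun [set: T1] f.
Proof.
move=> mf _ Y mY.
pose S : set (set 'rV[T2]_n) := [set A | measurable (setT `&` f @^-1` A)].
suff : measurable `<=` S by move=> /(_ Y mY).
apply: smallest_sub.
  split.
  - by rewrite /S /= preimage_set0 setI0.
  - move=> A; rewrite /S /= !setTI setTD preimage_setC => mA.
    exact: measurableC.
  - move=> F mF; rewrite /S /= setTI preimage_bigcup.
    by apply: bigcupT_measurable => k; have := mF k; rewrite /S /= setTI.
move=> A; rewrite -bigcup_seq => -[i _ [B mB <-]].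
rewrite /S /= setTI -comp_preimage.
by have := mf i measurableT B mB; rewrite !setTI.
Qed.

Section lebesgue_row.
Context {R : realType}.

Definition row_cons n (p : measurableTypeR R * 'rV[R]_n) : 'rV[R]_n.+1 :=
  row_mx (const_mx p.1) p.2 : 'rV[R]_(1 + n).

Definition row_tail n (v : 'rV[R]_n.+1) : 'rV[R]_n :=
  rsubmx (v : 'rV[R]_(1 + n)).

Lemma row_consK n (p : measurableTypeR R * 'rV[R]_n) :
  ((row_cons p) ord0 ord0, row_tail (row_cons p)) = p.
Proof.
case: p => a v; congr pair; last by rewrite /row_tail /row_cons row_mxKr.
have -> : (ord0 : 'I_n.+1) = lshift n (ord0 : 'I_1) by exact/val_inj.
by rewrite /row_cons (@row_mxEl _ 1 1 n) mxE.
Qed.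

Lemma measurable_row_cons n :
  measurable_fun [set: measurableTypeR R * 'rV[R]_n] (@row_cons n).
Proof.
apply: measurable_fun_rowP => i.
case: (split_ordP (i : 'I_(1 + n))) => j {i}->.
  rewrite (_ : (fun _ => _) = fst); first exact: measurable_fst.
  by apply/funext => p; rewrite /row_cons (@row_mxEl _ 1 1 n) mxE.
rewrite (_ : (fun _ => _) = (fun v : 'rV[R]_n => v ord0 j) \o snd).
  exact: measurableT_comp (@measurable_coord _ _ n j) measurable_snd.
by apply/funext => p; rewrite /row_cons (@row_mxEr _ 1 1 n).
Qed.

Lemma measurable_row_tail n : measurable_fun [set: 'rV[R]_n.+1] (@row_tail n).
Proof.
apply: measurable_fun_rowP => i.
under eq_fun do rewrite /row_tail mxE.
exact: measurable_coord.
Qed.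

Section step.
Variables (n : nat) (m : {sigma_finite_measure set 'rV[R]_n -> \bar R}).

Definition lebesgue_row_step : set 'rV[R]_n.+1 -> \bar R :=
  pushforward ((@lebesgue_measure R) \x m)%E (@row_cons n).

Let step0 : lebesgue_row_step set0 = 0%E.
Proof. by rewrite /lebesgue_row_step /pushforward preimage_set0 measure0. Qed.

Let step_ge0 A : (0 <= lebesgue_row_step A)%E.
Proof. by rewrite /lebesgue_row_step /pushforward measure_ge0. Qed.

Let step_sigma_additive : semi_sigma_additive lebesgue_row_step.
Proof.
have mc k A : measurable A -> measurable (@row_cons k @^-1` A).
  by move=> mA; rewrite -[X in measurable X]setTI; exact: measurable_row_cons.
move=> F mF tF mUF; rewrite /lebesgue_row_step /pushforward preimage_bigcup.
apply: measure_semi_sigma_additive => [k||]; first exact: mc.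
- apply/trivIsetP => /= i j _ _ ij; rewrite -preimage_setI.
  by move/trivIsetP : tF => /(_ _ _ _ _ ij) ->//; rewrite preimage_set0.
- by rewrite -preimage_bigcup; exact: mc.
Qed.

HB.instance Definition _ := isMeasure.Build _ _ _
  lebesgue_row_step step0 step_ge0 step_sigma_additive.

Lemma lebesgue_row_step_sigma_finite : sigma_finite setT lebesgue_row_step.
Proof.
have /sigma_finiteP[F [TF ndF Foo]] := sigma_finiteT (@lebesgue_measure R).
have /sigma_finiteP[G [TG ndG Goo]] := sigma_finiteT m.
pose h (v : 'rV[R]_n.+1) : measurableTypeR R * 'rV[R]_n :=
  (v ord0 ord0, row_tail v).
have mh : measurable_fun setT h.
  by apply: measurable_fun_pair;
    [exact: measurable_coord|exact: measurable_row_tail].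
exists (fun k => h @^-1` (F k `*` G k)).
  rewrite -preimage_bigcup predeqE => v; split=> // _.
  have [i _ Fi] : (\bigcup_k F k) (h v).1 by rewrite -TF.
  have [j _ Gj] : (\bigcup_k G k) (h v).2 by rewrite -TG.
  exists (maxn i j) => //; split.
  - by move: Fi; exact/subsetPset/ndF/leq_maxl.
  - by move: Gj; exact/subsetPset/ndG/leq_maxr.
move=> k; have [mF Fk] := Foo k; have [mG Gk] := Goo k; split.
  by rewrite -[X in measurable X]setTI; apply: mh => //; exact: measurableX.
rewrite /lebesgue_row_step /pushforward -comp_preimage.
rewrite (_ : h \o _ = id); last by apply/funext => p; exact: row_consK.
rewrite preimage_id product_measure1E//.
by apply: lte_mul_pinfty => //; rewrite ge0_fin_numE.
Qed.

HB.instance Definition _ := @Measure_isSigmaFinite.Build _ _ _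
  lebesgue_row_step lebesgue_row_step_sigma_finite.

End step.

Definition lebesgue_row0 : set 'rV[R]_0 -> \bar R := dirac (0 : 'rV[R]_0).

HB.instance Definition _ := Measure.on lebesgue_row0.

Lemma lebesgue_row0_sigma_finite : sigma_finite setT lebesgue_row0.
Proof.
apply: fin_num_fun_sigma_finite; first by rewrite measure0.
by move=> A mA; rewrite /lebesgue_row0 diracE.
Qed.

HB.instance Definition _ := @Measure_isSigmaFinite.Build _ _ _
  lebesgue_row0 lebesgue_row0_sigma_finite.

(* n-dimensional Lebesgue measure: the n-fold product of [lebesgue_measure],
   transported to row vectors. *)
Fixpoint lebesgue_row n : {sigma_finite_measure set 'rV[R]_n -> \bar R} :=
  if n is n'.+1 then lebesgue_row_step (lebesgue_row n') else lebesgue_row0.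

(* Membership in the completion of the Borel sigma-algebra. The library
   integral is a supremum over Borel simple functions lying below, so for such
   a set [E] it yields the usual Lebesgue integral over [E]. *)
Definition lebesgue_measurable n (E : set 'rV[R]_n) : Prop :=
  exists A B, [/\ measurable A, measurable B, A `<=` E, E `<=` B &
    lebesgue_row n (B `\` A) = 0%E].

End lebesgue_row.

Section euclidean.
Context {R : realType} {n : nat}.
Implicit Types (u v x : 'rV[R]_n).

Definition edot u v : R := \sum_(i < n) u ord0 i * v ord0 i.

(* The library norm on ['rV[R]_n] is the sup norm. *)
Definition enorm v : R := Num.sqrt (edot v v).

Definition eball x (r : R) : set 'rV[R]_n := [set y | enorm (y - x) < r].

End euclidean.

Section vector_radon_measure.
Context {R : realType} {n : nat}.
Implicit Types (D : set 'rV[R]_n -> 'rV[R]_n) (A B : set 'rV[R]_n).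

Definition vtotal_variation D B : \bar R :=
  ereal_sup [set (\sum_(0 <= k <oo) (enorm (D (P k)))%:E)%E |
    P in [set P : (set 'rV[R]_n)^nat |
      [/\ forall k, measurable (P k) /\ bounded_set (P k),
          trivIset setT P & \bigcup_k P k = B]]].

(* An R^n-valued Radon measure is a set function defined on the bounded Borel
   sets; its values on other sets are irrelevant. *)
Definition vector_radon D : Prop :=
  (forall P : (set 'rV[R]_n)^nat,
    (forall k, measurable (P k)) -> trivIset setT P ->
    bounded_set (\bigcup_k P k) ->
    series (fun k => D (P k)) @ \oo --> D (\bigcup_k P k)) /\
  (forall B, measurable B -> bounded_set B -> (vtotal_variation D B < +oo)%E).

(* Positive part of the Jordan decomposition of the i-th component of [D]. *)
Definition vvariation_pos D (i : 'I_n) B : \bar R :=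
  ereal_sup [set (D A ord0 i)%:E |
    A in [set A : set 'rV[R]_n | [/\ measurable A, bounded_set A & A `<=` B]]].

Definition vvariation_neg D : 'I_n -> set 'rV[R]_n -> \bar R :=
  vvariation_pos (fun A => - D A).

Definition vector_integral D (phi : 'rV[R]_n -> 'rV[R]_n) : R :=
  \sum_(i < n)
    (fine (\int[vvariation_pos D i]_y (phi y ord0 i)%:E)%E -
     fine (\int[vvariation_neg D i]_y (phi y ord0 i)%:E)%E).

Definition vmeasure_support D : set 'rV[R]_n :=
  [set x | forall r, 0 < r -> (0 < vtotal_variation D (eball x r))%E].

End vector_radon_measure.

Section test_fields.
Context {R : realType} {n : nat}.

Definition partial_derive (i : 'I_n) (f : 'rV[R]_n -> 'rV[R]_n) :
  'rV[R]_n -> 'rV[R]_n := fun x => 'D_(delta_mx ord0 i) f x.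

Definition smooth (f : 'rV[R]_n -> 'rV[R]_n) : Prop :=
  forall s : seq 'I_n, continuous (foldr partial_derive f s) /\
    forall i x, derivable (foldr partial_derive f s) x (delta_mx ord0 i).

Definition test_field (U : set 'rV[R]_n) (phi : 'rV[R]_n -> 'rV[R]_n) : Prop :=
  [/\ smooth phi, compact (closure [set x | phi x != 0]) &
      closure [set x | phi x != 0] `<=` U].

End test_fields.

Definition euler_gamma {R : realType} (z : R) : R :=
  \int[@lebesgue_measure R]_(t in `]0, +oo[) (t `^ (z - 1) * expR (- t)).

Definition frac_const {R : realType} (n : nat) (alpha : R) : R :=
  2 `^ alpha * pi `^ (- (n%:R / 2)) *
  euler_gamma ((n%:R + alpha + 1) / 2) / euler_gamma ((1 - alpha) / 2).

Section fractional_variation.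
Context {R : realType} {n : nat} (alpha : R).
Implicit Types (E F U : set 'rV[R]_n) (x y : 'rV[R]_n).

Definition frac_div (phi : 'rV[R]_n -> 'rV[R]_n) x : R :=
  frac_const n alpha * \int[lebesgue_row n]_y
    (edot (y - x) (phi y - phi x) / enorm (y - x) `^ (n%:R + alpha + 1)).

Definition frac_variation E U : \bar R :=
  ereal_sup [set (\int[lebesgue_row n]_(x in E) frac_div phi x)%:E |
    phi in [set phi | test_field U phi /\
      (Lnorm (lebesgue_row n) +oo (fun x => (enorm (phi x))%:E) <= 1)%E]].

Definition loc_finite_frac_perimeter E : Prop :=
  lebesgue_measurable E /\
  forall U, open U -> bounded_set U -> (frac_variation E U < +oo)%E.

Definition is_frac_gradient E (D : set 'rV[R]_n -> 'rV[R]_n) : Prop :=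
  [/\ vector_radon D,
      forall U, open U -> vtotal_variation D U = frac_variation E U &
      forall phi, test_field setT phi ->
        \int[lebesgue_row n]_(x in E) frac_div phi x =
        - vector_integral D phi].

(* The fractional gradient measure of the characteristic function of [E]. It
   exists, and is unique on bounded Borel sets, whenever
   [loc_finite_frac_perimeter E]; the zero default is never used then. *)
Definition frac_gradient E : set 'rV[R]_n -> 'rV[R]_n :=
  xget (fun=> 0) [set D | is_frac_gradient E D].

Definition frac_quotient E x (r : R) : 'rV[R]_n :=
  (fine (vtotal_variation (frac_gradient E) (eball x r)))^-1 *:
    frac_gradient E (eball x r).

Definition frac_normal E x : 'rV[R]_n := lim (frac_quotient E x @ 0^'+).

Definition frac_reduced_boundary E : set 'rV[R]_n :=
  [set x | [/\ vmeasure_support (frac_gradient E) x,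
               cvg (frac_quotient E x @ 0^'+) &
               enorm (frac_normal E x) = 1]].

End fractional_variation.

Section tangent.
Context {R : realType} {n : nat}.
Implicit Types (E F K : set 'rV[R]_n) (x : 'rV[R]_n).

Definition blow_up E x (r : R) : set 'rV[R]_n :=
  [set r^-1 *: (y - x) | y in E].

Definition cvg_L1loc (G : (set 'rV[R]_n)^nat) F : Prop :=
  forall K, compact K ->
    (\int[lebesgue_row n]_(y in K) (`|\1_(G k) y - \1_F y|)%:E)%E
      @[k --> \oo] --> 0%E.

Definition tangent_sets E x : set (set 'rV[R]_n) :=
  [set F | lebesgue_measurable F /\
    exists r : R^nat, [/\ forall k, 0 < r k, r @ \oo --> 0 &
      cvg_L1loc (fun k => blow_up E x (r k)) F]].

End tangent.

(* Main.v *)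
Require Import Defs.
From HB Require Import structures.
From mathcomp Require Import all_boot all_order all_algebra.
From mathcomp Require Import all_classical all_reals all_analysis.
From mathcomp Require Import measurable_realfun ess_sup_inf.
From mathcomp Require Import ring lra.

Import Order.TTheory GRing.Theory Num.Theory.
Import numFieldNormedType.Exports.

Local Open Scope classical_set_scope.
Local Open Scope ring_scope.

Set Implicit Arguments.
Unset Strict Implicit.
Unset Printing Implicit Defensive.

(** Let [nu] be the normal of [E] at [x]. Near [x] the gradient [D] of [E] is
    almost aligned with [nu]. Testing it against [f nu], where [f] is a radial
    bump whose superlevel sets are balls centered at [x], and using the scaling
    of the fractional divergence, one gets [|D|(B_r(x)) <= C r^(n - alpha)] for
    small [r]. The fractional variations of the blow-ups [(E - x) / r_k] are thus
    locally bounded, and so is that of their limit [F]. If moreover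
    [w . nu <= 0], then by alignment the integral of a nonnegative bump times [w]
    against the gradient of [(E - x) / r_k] is at most [o(1)], whence
    [w . DF(B) <= 0] for every ball [B], where [DF] is the gradient of [F].
    Hence [DF(B)] is a nonnegative multiple of [nu], and every normal of [F] is
    [nu], without exceptional set. The existence of [DF], a Riesz theorem, is
    not needed: without it [frac_gradient] is zero and has empty support. *)

(** * Euclidean geometry of row vectors *)

Section euclidean_norm.
Context {R : realType} {n : nat}.
Implicit Types (u v w x y : 'rV[R]_n) (a r : R).

(** Alignment at [x] is known only on balls centered at [x], whereas the limit must be tested on
    arbitrary balls. For the density bound this dictates radial test functions: a layer-cake
    argument then meets centered balls only. For off-center bumps a defect argument takes over. The
    defect |D|(B) - nu . D(B) of a centered ball is at most e^2 |D|(B); it bounds the defect |D(A)|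
    - nu . D(A) of every Borel subset A, and so keeps D(A) within order e |D|(B) of the direction
    [nu]. Rescaling divides this error by r_k^(n - alpha), which is why the density bound must come
    first. A second obstacle is nonlocality: the fractional divergence of a compactly supported
    field need not have compact support. Local convergence of the sets is therefore paired with
    global integrability of the divergence and a tail estimate. Limits are taken only in integrals
    of one fixed divergence over varying sets, never in the gradients. Finally, the sets are merely
    Lebesgue measurable, so each is replaced by a Borel subset of full measure before its integrals
    are transformed. *)

Lemma edotC u v : edot u v = edot v u.
Proof. by rewrite /edot; apply: eq_bigr => i _; rewrite mulrC. Qed.

Lemma edotDl u v w : edot (u + v) w = edot u w + edot v w.
Proof.
rewrite /edot -big_split/=; apply: eq_bigr => i _.
by rewrite mxE mulrDl.
Qed.

Lemma edotZl a u v : edot (a *: u) v = a * edot u v.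
Proof.
by rewrite /edot mulr_sumr; apply: eq_bigr => i _; rewrite mxE mulrA.
Qed.

Lemma edotDr u v w : edot w (u + v) = edot w u + edot w v.
Proof. by rewrite edotC edotDl !(edotC w). Qed.

Lemma edotZr a u v : edot u (a *: v) = a * edot u v.
Proof. by rewrite edotC edotZl edotC. Qed.

Lemma edotNl u v : edot (- u) v = - edot u v.
Proof. by rewrite -scaleN1r edotZl mulN1r. Qed.

Lemma edotNr u v : edot u (- v) = - edot u v.
Proof. by rewrite edotC edotNl edotC. Qed.

Lemma edotBl u v w : edot (u - v) w = edot u w - edot v w.
Proof. by rewrite edotDl edotNl. Qed.

Lemma edotBr u v w : edot w (u - v) = edot w u - edot w v.
Proof. by rewrite edotDr edotNr. Qed.

Lemma edot0l u : edot 0 u = 0.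
Proof. by rewrite -(scale0r 0) edotZl mul0r. Qed.

Lemma edot_ge0 u : 0 <= edot u u.
Proof. by apply: sumr_ge0 => i _; rewrite -expr2 sqr_ge0. Qed.

Lemma enorm_ge0 u : 0 <= enorm u.
Proof. exact: sqrtr_ge0. Qed.

Lemma sqr_enorm u : enorm u ^+ 2 = edot u u.
Proof. by rewrite sqr_sqrtr// edot_ge0. Qed.

Lemma enorm0 : enorm (0 : 'rV[R]_n) = 0.
Proof. by rewrite /enorm edot0l sqrtr0. Qed.

Lemma enormZ a u : enorm (a *: u) = `|a| * enorm u.
Proof.
rewrite /enorm edotZl edotZr mulrA -expr2 sqrtrM ?sqr_ge0//.
by rewrite sqrtr_sqr.
Qed.

Lemma enormN u : enorm (- u) = enorm u.
Proof. by rewrite -scaleN1r enormZ normrN1 mul1r. Qed.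

Lemma coord_le_enorm u i : `|u ord0 i| <= enorm u.
Proof.
rewrite -sqrtr_sqr ler_wsqrtr// /edot (bigD1 i)//= -expr2 lerDl.
by apply: sumr_ge0 => j _; rewrite -expr2 sqr_ge0.
Qed.

Lemma enorm_eq0 u : enorm u = 0 -> u = 0.
Proof.
move=> u0; apply/rowP => i; rewrite mxE; apply/eqP.
by rewrite -normr_le0 -u0 coord_le_enorm.
Qed.

Lemma enorm_gt0 u : u != 0 -> 0 < enorm u.
Proof.
move=> u0; rewrite lt_neqAle enorm_ge0 andbT eq_sym.
by apply: contra u0 => /eqP/enorm_eq0/eqP.
Qed.

Lemma coord_le_norm u i : `|u ord0 i| <= `|u|.
Proof.
rewrite [leRHS]mx_normrE.
by apply: (le_bigmax _ (fun ij => `|u ij.1 ij.2|) (ord0, i)).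
Qed.

Lemma norm_le u r : 0 <= r -> (forall i, `|u ord0 i| <= r) -> `|u| <= r.
Proof.
move=> r0 ur; rewrite [leLHS]mx_normrE.
by apply: bigmax_le => // -[i j] _ /=; rewrite ord1.
Qed.

Lemma norm_le_enorm u : `|u| <= enorm u.
Proof. by apply: norm_le; [exact: enorm_ge0|exact: coord_le_enorm]. Qed.

(** Cauchy-Schwarz, from the nonnegative square of |v|^2 u - (u . v) v. *)
Lemma normr_edot_le u v : `|edot u v| <= enorm u * enorm v.
Proof.
have [->|/enorm_gt0 v0] := eqVneq v 0.
  by rewrite edotC edot0l enorm0 mulr0 normr0.
have := edot_ge0 ((enorm v ^+ 2) *: u - edot u v *: v).
rewrite edotBl !edotBr !edotZl !edotZr -!sqr_enorm (edotC v u) => h.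
have {}h : 0 <= enorm v ^+ 2 * ((enorm u * enorm v) ^+ 2 - edot u v ^+ 2).
  by rewrite (le_trans h)// le_eqVlt; apply/orP; left; apply/eqP; ring.
rewrite -ler_sqr ?nnegrE ?mulr_ge0 ?enorm_ge0// -subr_ge0 real_normK ?num_real//.
by move: h; rewrite pmulr_rge0// exprn_gt0.
Qed.

Lemma enorm_le_norm u : enorm u <= n%:R * `|u|.
Proof.
rewrite -ler_sqr ?nnegrE ?mulr_ge0 ?enorm_ge0// sqr_enorm exprMn.
apply: (@le_trans _ _ (\sum_(i < n) `|u| ^+ 2)).
  apply: ler_sum => i _; rewrite -expr2 -real_normK ?num_real//.
  by rewrite ler_sqr ?nnegrE// coord_le_norm.
rewrite sumr_const card_ord -[leLHS]mulr_natl ler_wpM2r ?sqr_ge0//.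
by rewrite -natrX ler_nat -mulnn; have [n0|] := posnP n; [rewrite [in leqLHS]n0|exact: leq_pmull].
Qed.

End euclidean_norm.

Lemma cvg_sumr (K : numFieldType) (V : normedModType K) (T : Type)
    (F : set_system T) {FF : Filter F} (I : Type) (r : seq I) (f : I -> T -> V) l :
  (forall i, f i @ F --> l i) ->
  (fun t => \sum_(i <- r) f i t) @ F --> \sum_(i <- r) l i.
Proof.
move=> fl; elim: r => [|i r IH].
  by rewrite big_nil; under eq_fun do rewrite big_nil; exact: cvg_cst.
rewrite big_cons; under eq_fun do rewrite big_cons.
exact: cvgD.
Qed.

Section euclidean_topology.
Context {R : realType} {n : nat}.
Implicit Types (u v w x y : 'rV[R]_n) (a r : R).

Lemma coord_cvg (T : Type) (F : set_system T) {FF : Filter F}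
    (f : T -> 'rV[R]_n) v i :
  f @ F --> v -> (fun t => f t ord0 i) @ F --> v ord0 i.
Proof.
move=> fv; apply: (cvg_comp _ (fun v : 'rV[R]_n => v ord0 i) fv).
exact: coord_continuous.
Qed.

Lemma edot_cvg (T : Type) (F : set_system T) {FF : Filter F}
    (f g : T -> 'rV[R]_n) u v :
  f @ F --> u -> g @ F --> v -> (fun t => edot (f t) (g t)) @ F --> edot u v.
Proof.
move=> fu gv; rewrite /edot; apply: cvg_sumr => i.
by apply: cvgM; exact: coord_cvg.
Qed.

Lemma enorm_cvg (T : Type) (F : set_system T) {FF : Filter F}
    (f : T -> 'rV[R]_n) u :
  f @ F --> u -> (fun t => enorm (f t)) @ F --> enorm u.
Proof.
move=> fu; apply: (cvg_comp _ Num.sqrt (edot_cvg fu fu)).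
exact: sqrt_continuous.
Qed.

Lemma enorm_continuous : continuous (@enorm R n).
Proof. by move=> x; exact: (@enorm_cvg _ (nbhs x) _ id). Qed.

Lemma open_eball x r : open (eball x r).
Proof.
have -> : eball x r = (fun y => enorm (y - x)) @^-1` [set t | t < r] by [].
apply: open_comp; last exact: open_lt.
move=> y _; apply: (@enorm_cvg _ (nbhs y) _ (fun z => z - x) (y - x)).
by apply: cvgB; [exact: cvg_id|exact: cvg_cst].
Qed.

Lemma bounded_setP (A : set 'rV[R]_n) :
  bounded_set A <-> exists M : R, forall x, A x -> `|x| <= M.
Proof.
split=> [[M [_ AM]]|[M AM]].
  by exists (M + 1) => x Ax; apply: AM => //; rewrite ltrDl.
by exists M; split; [exact: num_real|move=> N MN x /AM /le_trans; apply; exact: ltW].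
Qed.

Lemma bounded_eball x r : bounded_set (eball x r).
Proof.
apply/bounded_setP; exists (r + `|x|) => y; rewrite /eball/= => yr.
rewrite -(subrK x y); apply: (le_trans (ler_normD _ _)).
by rewrite lerD2r; apply: le_trans (norm_le_enorm _) _; exact: ltW.
Qed.

Lemma sub_bounded (A B : set 'rV[R]_n) :
  A `<=` B -> bounded_set B -> bounded_set A.
Proof.
by move=> AB /bounded_setP[M BM]; apply/bounded_setP; exists M => x /AB /BM.
Qed.

Lemma bounded_sub_eball (A : set 'rV[R]_n) : bounded_set A ->
  exists2 r, 0 < r & A `<=` eball 0 r.
Proof.
move=> /bounded_setP[M AM]; exists (n%:R * `|M| + 1).
  by rewrite ltr_wpDl// mulr_ge0.
move=> x Ax; rewrite /eball /= subr0 (le_lt_trans (enorm_le_norm _))//.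
rewrite ltr_pwDr// ler_wpM2l// (le_trans (AM _ Ax))//; exact: ler_norm.
Qed.

(** Rational boxes form a countable base and lie in the product sigma-algebra; this is where
    topology and measurability of row vectors meet. *)
Lemma measurable_open_row (U : set 'rV[R]_n) : open U -> measurable U.
Proof.
move=> oU.
pose box (p : 'rV[rat]_n * rat) : set 'rV[R]_n :=
  [set y | forall i, `|y ord0 i - ratr (p.1 ord0 i)| < ratr p.2].
have mbox p : measurable (box p).
  have -> : box p = \bigcap_(i in [set: 'I_n])
      ((fun y => y ord0 i) @^-1` ball (ratr (p.1 ord0 i) : R) (ratr p.2)).
    apply/seteqP; split => y /= h i.
      by move=> _; rewrite /= -ball_normE /= distrC; exact: h.
    by have := h i I; rewrite /= -ball_normE /= distrC.
  apply: fin_bigcap_measurable => // i _.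
  rewrite -[X in measurable X]setTI; apply: measurable_coord => //.
  exact: measurable_ball.
have -> : U = \bigcup_(p in [set p | box p `<=` U]) box p.
  apply/seteqP; split => [y Uy|y [p /= pU] /pU//].
  have /nbhs_ballP[e /= e0 yeU] : nbhs y U by exact: open_nbhs_nbhs.
  (* Half of [e]: the rational center lies within [q] of [y] and the box has sup-radius [q], so its
     points stay within [2 q < e] of [y]. *)
  have [q] := @rat_in_itvoo R 0 (e / 2) (divr_gt0 e0 (ltr0Sn _ _)).
  rewrite in_itv /= => /andP[q0 qe].
  have ex i : exists t : rat, `|y ord0 i - ratr t| < ratr q.
    have yq : y ord0 i < y ord0 i + ratr q by rewrite ltrDl.
    have [t] := rat_in_itvoo yq.
    rewrite in_itv /= => /andP[t1 t2]; exists t.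
    by rewrite ltr_norml; apply/andP; split; lra.
  pose c := \row_i sval (cid (ex i)).
  exists (c, q).
    move=> z /= zc; apply: yeU; rewrite -ball_normE /= .
    apply: (@le_lt_trans _ _ (ratr q + ratr q)); last lra.
    apply: norm_le => [|i]; first by lra.
    rewrite !mxE; have := zc i; rewrite /= /c mxE; case: cid => t /= yt zt.
    have -> : y ord0 i - z ord0 i = (y ord0 i - ratr t) - (z ord0 i - ratr t).
      by ring.
    apply: (le_trans (ler_normB _ _)); lra.
  by move=> i /=; rewrite /c mxE; case: cid.
rewrite bigcup_mkcond; apply: countable_bigcupT_measurable => [|p].
  exact: countableP.
by case: ifPn.
Qed.

Lemma continuous_measurable_row (f : 'rV[R]_n -> R) :
  continuous f -> measurable_fun setT f.
Proof.
move=> /continuousP cf; apply: (measurability _ (RGenOpens.measurableE R)).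
move=> _ [_ [a [b ->]] <-]; rewrite setTI; apply: measurable_open_row.
exact/cf/interval_open.
Qed.

End euclidean_topology.

Lemma measurable_eball (R : realType) n (x : 'rV[R]_n) r :
  measurable (eball x r).
Proof. by apply: measurable_open_row; exact: open_eball. Qed.

Section measurable_row_maps.
Context {R : realType} {n : nat} d (T : measurableType d).

Lemma measurable_rowD (f g : T -> 'rV[R]_n) :
  measurable_fun setT f -> measurable_fun setT g ->
  measurable_fun setT (fun t => f t + g t).
Proof.
move=> mf mg; apply: measurable_fun_rowP => i; under eq_fun do rewrite mxE.
apply: measurable_funD; exact: (measurableT_comp (measurable_coord _)).
Qed.

Lemma measurable_rowZ (a : R) (f : T -> 'rV[R]_n) :
  measurable_fun setT f -> measurable_fun setT (fun t => a *: f t).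
Proof.
move=> mf; apply: measurable_fun_rowP => i; under eq_fun do rewrite mxE.
apply: measurable_funM => //; exact: (measurableT_comp (measurable_coord _)).
Qed.

Lemma measurable_enorm (f : T -> 'rV[R]_n) :
  measurable_fun setT f -> measurable_fun setT (fun t => enorm (f t)).
Proof.
apply: measurableT_comp; apply: continuous_measurable_row.
exact: enorm_continuous.
Qed.

Lemma measurable_edot (f g : T -> 'rV[R]_n) :
  measurable_fun setT f -> measurable_fun setT g ->
  measurable_fun setT (fun t => edot (f t) (g t)).
Proof.
move=> mf mg; apply: measurable_sum => i.
apply: measurable_funM; exact: (measurableT_comp (measurable_coord _)).
Qed.

End measurable_row_maps.

Lemma continuous_measurable_rowf (R : realType) n m (f : 'rV[R]_n -> 'rV[R]_m) :
  continuous f -> measurable_fun setT f.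
Proof.
move=> cf; apply: measurable_fun_rowP => i; apply: continuous_measurable_row.
by move=> x; apply: (@coord_cvg _ _ _ (nbhs x) _ f (f x)); exact: cf.
Qed.

Section bounded_sets.
Context {R : realType} {n : nat}.
Implicit Types (A B : set 'rV[R]_n).

Lemma bounded_setU A B :
  bounded_set A -> bounded_set B -> bounded_set (A `|` B).
Proof.
move=> /bounded_setP[M AM] /bounded_setP[N BN]; apply/bounded_setP.
by exists (Num.max M N) => x [/AM|/BN] xM; rewrite le_max xM ?orbT.
Qed.

Lemma bounded_set0 : bounded_set (@set0 'rV[R]_n).
Proof. by apply/bounded_setP; exists 0. Qed.

End bounded_sets.

(** * Vector-valued Radon measures *)

Section radon_additivity.
Context {R : realType} {n : nat}.
Variable D : set 'rV[R]_n -> 'rV[R]_n.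
Hypothesis hD : vector_radon D.
Implicit Types (A B : set 'rV[R]_n).

(** The constant sequence of empty sets makes the series with constant term [D set0] converge, so
    this term is a null sequence. *)
Lemma radon0 : D set0 = 0.
Proof.
have t0 : trivIset [set: nat] (fun=> @set0 'rV[R]_n).
  by apply/trivIsetP => i j _ _ _; rewrite setI0.
have [+ _] := hD => /(_ (fun=> set0) (fun=> measurable0) t0).
rewrite bigcup0// => /(_ bounded_set0) h.
have /cvg_series_cvg_0 h0 : cvgn (series (fun=> D set0)).
  by apply/cvg_ex; exists (D set0).
by rewrite -(cvg_lim (@norm_hausdorff _ _) h0) lim_cst//; exact: norm_hausdorff.
Qed.

Lemma radonU A B : measurable A -> measurable B -> bounded_set A ->
  bounded_set B -> A `&` B = set0 -> D (A `|` B) = D A + D B.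
Proof.
move=> mA mB bA bB AB.
have [/(_ (bigcup2 A B)) + _] := hD; rewrite bigcup2E => h.
have {}h : series (fun k => D (bigcup2 A B k)) @ \oo --> D (A `|` B).
  apply: h; [by case=> [|[|k]]; rewrite /bigcup2 /=| |exact: bounded_setU].
  by rewrite -trivIset_bigcup2.
rewrite -(cvg_lim (@norm_hausdorff _ _) h).
apply: lim_near_cst; first exact: norm_hausdorff.
exists 2%N => // k /= k2.
rewrite /series /= -(subnK k2) addnC big_mkord big_split_ord /=.
rewrite !big_ord_recl big_ord0 /= addr0.
by rewrite [X in _ + X]big1 ?addr0// => j _; exact: radon0.
Qed.

Lemma radonD A B : measurable A -> measurable B -> bounded_set B ->
  A `<=` B -> D B = D A + D (B `\` A).
Proof.
move=> mA mB bB AB; rewrite -radonU ?setDUK//; first exact: measurableD.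
- exact: sub_bounded AB bB.
- exact: sub_bounded (@subDsetl _ _ _) bB.
- by rewrite setIC setDKI.
Qed.

(** The partition is [A], [B \ A], then empty sets. Both terms are kept, not only the first: the
    second one later controls the alignment defect of subsets. *)
Lemma variation_ge2 A B : measurable A -> measurable B -> bounded_set B ->
  A `<=` B ->
  ((enorm (D A) + enorm (D (B `\` A)))%:E <= vtotal_variation D B)%E.
Proof.
move=> mA mB bB AB; apply: le_ereal_sup_tmp => /=.
exists (\sum_(0 <= k <oo) (enorm (D (bigcup2 A (B `\` A) k)))%:E)%E.
  exists (bigcup2 A (B `\` A)) => //=; split.
  - move=> [|[|k]]; rewrite /bigcup2/=.
    + by split => //; exact: sub_bounded AB bB.
    + by split; [exact: measurableD|exact: sub_bounded (@subDsetl _ _ _) bB].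
    + by split => //; exact: bounded_set0.
  - by rewrite -trivIset_bigcup2 setIC setDKI.
  - by rewrite bigcup2E setDUK.
apply: le_trans (@nneseries_lim_ge _ _ _ _ 2 _) => [|k _].
  by rewrite !big_nat_recl// big_geq// adde0.
by rewrite lee_fin enorm_ge0.
Qed.

Lemma variation_fin B : measurable B -> bounded_set B ->
  vtotal_variation D B \is a fin_num.
Proof.
move=> mB bB; have [_ /(_ B mB bB) BD] := hD; rewrite ge0_fin_numE//.
apply: le_trans (variation_ge2 mB mB bB (@subset_refl _ _)).
by rewrite lee_fin addr_ge0 ?enorm_ge0.
Qed.

Lemma enorm_variation A B : measurable A -> measurable B -> bounded_set B ->
  A `<=` B -> enorm (D A) <= fine (vtotal_variation D B).
Proof.
move=> mA mB bB AB; rewrite -lee_fin fineK ?variation_fin//.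
apply: le_trans (variation_ge2 mA mB bB AB).
by rewrite lee_fin lerDl enorm_ge0.
Qed.

(** A partition of [A] becomes one of [B] once [B \ A] is put in front, and the sum can only
    grow. *)
Lemma variation_mono A B : measurable A -> measurable B -> bounded_set B ->
  A `<=` B -> fine (vtotal_variation D A) <= fine (vtotal_variation D B).
Proof.
move=> mA mB bB AB; have bA := sub_bounded AB bB.
rewrite fine_le ?variation_fin//.
apply: ge_ereal_sup => _ [P [mP tP PA] <-].
pose Q k := if k is k'.+1 then P k' else B `\` A.
have QP : (\sum_(0 <= k <oo) (enorm (D (P k)))%:E <=
          \sum_(0 <= k <oo) (enorm (D (Q k)))%:E)%E.
  rewrite [leRHS]nneseries_recl//; last by move=> k; rewrite lee_fin enorm_ge0.
  rewrite -(nneseries_addn 1)//=; last by move=> k; rewrite lee_fin enorm_ge0.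
  rewrite [X in (_ <= _ + X)%E](eq_eseriesr (g := fun k => (enorm (D (P k)))%:E)); last first.
    by move=> k _; rewrite addn1.
  by rewrite leeDr// lee_fin enorm_ge0.
apply: le_trans QP _; apply: ereal_sup_ubound; exists Q => //; split.
- move=> [|k]; last exact: mP.
  by split; [exact: measurableD|exact: sub_bounded (@subDsetl _ _ _) bB].
- apply/trivIsetP => -[|i] [|j] _ _ //= ij.
  + by apply/seteqP; split=> // x [[_ nA] Px]; apply: nA; rewrite -PA; exists j.
  + by apply/seteqP; split=> // x [Px [_ nA]]; apply: nA; rewrite -PA; exists i.
  + by move/trivIsetP : tP; apply.
- apply/seteqP; split=> [x [[|k] _] /=|x Bx].
  + by case.
  + by move=> Px; apply: AB; rewrite -PA; exists k.
  + have [Ax|nAx] := pselect (A x); last by exists 0%N.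
    by move: Ax; rewrite -PA => -[k _ Px]; exists k.+1.
Qed.

End radon_additivity.

Lemma vector_radonN (R : realType) n (D : set 'rV[R]_n -> 'rV[R]_n) :
  vector_radon D -> vector_radon (fun A => - D A).
Proof.
move=> [sD fD]; split=> [P mP tP bP|B mB bB].
  have := sD P mP tP bP => /cvgN; apply: cvg_trans.
  apply: near_eq_cvg; near=> k.
  by rewrite /series /= sumrN.
rewrite (_ : vtotal_variation _ B = vtotal_variation D B); first exact: fD.
rewrite /vtotal_variation; congr ereal_sup.
suff : (fun P => \sum_(0 <= k <oo) (enorm (- D (P k)))%:E)%E =
       (fun P => \sum_(0 <= k <oo) (enorm (D (P k)))%:E)%E by move=> ->.
by apply/funext => P; apply: eq_eseriesr => k _; rewrite enormN.
Unshelve. all: by end_near. Qed.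

Section jordan.
Context {R : realType} {n : nat}.
Variable D : set 'rV[R]_n -> 'rV[R]_n.
Hypothesis hD : vector_radon D.
Variable i : 'I_n.
Implicit Types (A B : set 'rV[R]_n).
Local Notation V := (vvariation_pos D i).

Lemma vvariation_pos_ge A B : measurable A -> bounded_set A -> A `<=` B ->
  ((D A ord0 i)%:E <= V B)%E.
Proof. by move=> mA bA AB; apply: ereal_sup_ubound; exists A. Qed.

Lemma vvariation_pos_ge0 B : (0 <= V B)%E.
Proof.
have := vvariation_pos_ge measurable0 bounded_set0 (@sub0set _ B).
by rewrite radon0// mxE.
Qed.

Lemma vvariation_pos0 : V set0 = 0%E.
Proof.
apply/eqP; rewrite eq_le vvariation_pos_ge0 andbT.
by apply: ge_ereal_sup => _ [A [_ _ +] <-]; rewrite subset0 => ->; rewrite radon0// mxE.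
Qed.

Lemma vvariation_pos_le B : measurable B -> bounded_set B ->
  (V B <= vtotal_variation D B)%E.
Proof.
move=> mB bB; apply: ge_ereal_sup => _ [A [mA bA AB] <-].
apply: le_trans (variation_ge2 _ mA mB bB AB); rewrite lee_fin.
apply: (le_trans (ler_norm _)); apply: (le_trans (coord_le_enorm _ _)).
by rewrite lerDl enorm_ge0.
Qed.

Lemma vvariation_pos_fin B : measurable B -> bounded_set B ->
  V B \is a fin_num.
Proof.
move=> mB bB; rewrite ge0_fin_numE ?vvariation_pos_ge0//.
apply: (le_lt_trans (vvariation_pos_le mB bB)).
by have := variation_fin hD mB bB; rewrite fin_numE ltey => /andP[].
Qed.

Lemma vvariation_pos_mono A B : A `<=` B -> (V A <= V B)%E.
Proof.
move=> AB; apply: ereal_sup_le => _ [C [mC bC CA] <-].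
by exists C => //; split=> //; exact: subset_trans AB.
Qed.

(** Competitors for [A] and [B] are disjoint, so their union competes for [A] united with [B]. No
    measurability of [A] or [B] enters. *)
Lemma vvariation_pos_superadd A B : A `&` B = set0 ->
  (V A + V B <= V (A `|` B))%E.
Proof.
move=> AB.
have [->|] := eqVneq (V (A `|` B)) +oo%E; first by rewrite leey.
rewrite -ltey => Vfin.
have VBfin : V B \is a fin_num.
  rewrite ge0_fin_numE ?vvariation_pos_ge0//.
  by apply: le_lt_trans Vfin; exact/vvariation_pos_mono/subsetUr.
rewrite -leeBrDr//; apply: ge_ereal_sup => _ [A' [mA bA AA] <-].
rewrite leeBrDr// addeC -leeBrDr//; apply: ge_ereal_sup => _ [B' [mB bB BB] <-].
have AB0 : A' `&` B' = set0.
  by apply/seteqP; split=> // x [/AA Ax /BB Bx]; rewrite -AB.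
rewrite leeBrDr// -EFinD addrC.
rewrite (_ : _ + _ = D (A' `|` B') ord0 i); last by rewrite radonU// mxE.
apply: vvariation_pos_ge; [exact: measurableU|exact: bounded_setU|exact: setUSS].
Qed.

(** Superadditivity on finite unions gives one inequality. For the other, a bounded competitor is
    cut along the [F k], where countable additivity of [D] applies because the competitor is
    bounded. *)
Lemma vvariation_pos_sigma_additive : semi_sigma_additive V.
Proof.
move=> F mF tF mUF.
have cF : cvgn (fun k => \sum_(0 <= j < k) V (F j))%E.
  by apply: is_cvg_nneseries => k _ _; exact: vvariation_pos_ge0.
suff -> : V (\bigcup_k F k) = (\sum_(0 <= j <oo) V (F j))%E by [].
apply/eqP; rewrite eq_le; apply/andP; split; last first.
  apply: lime_le => //; apply: nearW => k.
  apply: (@le_trans _ _ (V (\big[setU/set0]_(j < k) F j))); last first.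
    by apply: vvariation_pos_mono; exact: bigsetU_bigcup.
  rewrite big_mkord; elim: k => [|k IH].
    by rewrite !big_ord0 vvariation_pos0.
  rewrite !big_ord_recr /=; apply: le_trans (leeD2r _ IH) _.
  apply: vvariation_pos_superadd.
  apply/seteqP; split=> // x []; rewrite -bigcup_mkord => -[j /= jk Fj] Fk.
  move/trivIsetP : tF => /(_ j k I I); rewrite (ltn_eqF jk) => /(_ isT) jk0.
  by have : (F j `&` F k) x by []; rewrite jk0.
apply: ge_ereal_sup => _ [A [mA bA AF] <-].
set S := (\sum_(0 <= j <oo) V (F j))%E.
have [->|] := eqVneq S +oo%E; first by rewrite leey.
have S0 : (0 <= S)%E by apply: nneseries_ge0 => k _ _; exact: vvariation_pos_ge0.
rewrite -ltey => Sfin; rewrite -(@fineK _ S) ?ge0_fin_numE// lee_fin.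
have AE : \bigcup_k (A `&` F k) = A.
  by rewrite -setI_bigcupr; apply/setIidl.
have : series (fun k => D (A `&` F k)) @ \oo --> D A.
  have [+ _] := hD => /(_ (fun k => A `&` F k)); rewrite AE; apply => //.
  - by move=> k; exact: measurableI.
  - apply/trivIsetP => p q _ _ pq; rewrite setIACA.
    by move/trivIsetP : tF => /(_ p q) ->//; rewrite setI0.
move=> /(@coord_cvg _ _ _ _ _ _ _ i) h.
rewrite -(cvg_lim _ h)//; apply: limr_le; first by apply/cvg_ex; eexists; exact: h.
apply: nearW => k; rewrite -lee_fin fineK ?ge0_fin_numE//.
apply: le_trans (@nneseries_lim_ge _ _ _ _ k _) => [|j _].
  rewrite /series /= summxE -sumEFin; apply: lee_sum => j _.
  by apply: vvariation_pos_ge => //; [exact: measurableI|exact: sub_bounded bA].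
by move=> _; exact: vvariation_pos_ge0.
Qed.

End jordan.

Section jordan_measures.
Context {R : realType} {n : nat} (D : set 'rV[R]_n -> 'rV[R]_n).
Hypothesis hD : vector_radon D.
Variable i : 'I_n.

(** The anonymous argument carries the proof that [D] is Radon, on which the measure structure below
    depends. The negative part is the same measure built from [- D]. *)
Definition pos_measure of vector_radon D := vvariation_pos D i.

HB.instance Definition _ := isMeasure.Build _ _ _ (pos_measure hD)
  (vvariation_pos0 hD i) (vvariation_pos_ge0 hD i)
  (vvariation_pos_sigma_additive (i := i) hD).

End jordan_measures.

(** * Integration against vector-valued Radon measures *)

Section bounded_support.
Context {R : realType} {n : nat}.
Implicit Types (f g : 'rV[R]_n -> R) (A B : set 'rV[R]_n).

(** The class of scalar functions on which integration against [D] is linear: for a bounded Borel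
    [B], both Jordan parts are finite on [B], so such functions are integrable. *)
Definition bounded_support (B : set 'rV[R]_n) f :=
  [/\ measurable_fun setT f, exists M, forall x, `|f x| <= M &
      forall x, ~ B x -> f x = 0].

Lemma bounded_support_integrable B f
    (mu : {measure set 'rV[R]_n -> \bar R}) :
  measurable B -> (mu B < +oo)%E -> bounded_support B f ->
  mu.-integrable setT (EFin \o f).
Proof.
move=> mB muB [mf [M fM] fB].
have -> : EFin \o f = (EFin \o f) \_ B.
  apply/funext => x; rewrite /patch; case: ifPn => //=.
  by rewrite notin_setE => /fB ->.
apply/(integrable_mkcond _ mB); apply: measurable_bounded_integrable => //.
  exact: measurable_funS mf.
by exists M; split; [exact: num_real|move=> N MN x _ /=; rewrite (le_trans (fM x))// ltW].
Qed.

Lemma bounded_supportD B f g : bounded_support B f -> bounded_support B g ->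
  bounded_support B (fun x => f x + g x).
Proof.
move=> [mf [M fM] fB] [mg [N gN] gB]; split; first exact: measurable_funD.
- exists (M + N) => x; apply: (le_trans (ler_normD _ _)).
  by rewrite lerD.
- by move=> x Bx; rewrite fB// gB// addr0.
Qed.

Lemma bounded_supportZ B f a : bounded_support B f ->
  bounded_support B (fun x => a * f x).
Proof.
move=> [mf [M fM] fB]; split; first exact: measurable_funM.
- by exists (`|a| * M) => x; rewrite normrM ler_wpM2l.
- by move=> x Bx; rewrite fB// mulr0.
Qed.

Lemma bounded_supportB B f g : bounded_support B f -> bounded_support B g ->
  bounded_support B (fun x => f x - g x).
Proof.
move=> hf hg; have := bounded_supportD hf (bounded_supportZ (- 1) hg).
by under eq_fun do rewrite mulN1r.
Qed.

Lemma bounded_support_indic A B : measurable A -> A `<=` B ->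
  bounded_support B (\1_A : 'rV[R]_n -> R).
Proof.
move=> mA AB; split; first exact: measurable_indic.
- by exists 1 => x; rewrite indicE; case: (_ \in _); rewrite ?normr1 ?normr0.
- by move=> x Bx; rewrite indicE memNset//; apply: contra_not Bx => /AB.
Qed.

Lemma bounded_support_sum B (I : Type) (r : seq I) (f : I -> 'rV[R]_n -> R) :
  (forall i, bounded_support B (f i)) ->
  bounded_support B (fun x => \sum_(i <- r) f i x).
Proof.
move=> fB; elim: r => [|i r IH].
  under eq_fun do rewrite big_nil.
  by split => //; exists 0 => x; rewrite normr0.
by under eq_fun do rewrite big_cons; exact: bounded_supportD.
Qed.

End bounded_support.

Section scalar_vector_integral.
Context {R : realType} {n : nat}.
Variable D : set 'rV[R]_n -> 'rV[R]_n.
Hypothesis hD : vector_radon D.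
Variables (B : set 'rV[R]_n).
Hypotheses (mB : measurable B) (bB : bounded_set B).
Implicit Types (f g : 'rV[R]_n -> R) (A : set 'rV[R]_n) (w : 'rV[R]_n).

Local Notation mup i := (pos_measure i hD).
Local Notation mun i := (pos_measure i (vector_radonN hD)).
Local Notation L w f := (vector_integral D (fun y => f y *: w)).

Let integrable_mup i f : bounded_support B f ->
  (mup i).-integrable setT (EFin \o f).
Proof.
apply: bounded_support_integrable => //.
by have := vvariation_pos_fin hD i mB bB; rewrite fin_numE ltey => /andP[].
Qed.

Let integrable_mun i f : bounded_support B f ->
  (mun i).-integrable setT (EFin \o f).
Proof.
apply: bounded_support_integrable => //.
have := vvariation_pos_fin (vector_radonN hD) i mB bB.
by rewrite fin_numE ltey => /andP[].
Qed.

Lemma vector_integralE w f : bounded_support B f ->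
  L w f = \sum_(i < n) w ord0 i *
    (\int[mup i]_y f y - \int[mun i]_y f y).
Proof.
move=> hf; rewrite /vector_integral; apply: eq_bigr => i _.
rewrite -[X in _ = X]mulrC mulrBl -!RintegralZr//; [|exact: integrable_mun|exact: integrable_mup].
suff -> : (fun y => ((f y *: w) ord0 i)%:E) = (fun y => (f y * w ord0 i)%:E) by [].
by apply/funext => y; rewrite mxE mulrC.
Qed.

Lemma vector_integralD w f g : bounded_support B f -> bounded_support B g ->
  L w (fun x => f x + g x) = L w f + L w g.
Proof.
move=> hf hg; rewrite !vector_integralE//; last exact: bounded_supportD.
rewrite -big_split/=; apply: eq_bigr => i _.
rewrite !RintegralD//; [ring| | | |]; do ?[exact: integrable_mup|exact: integrable_mun].
Qed.

Lemma vector_integralZ w f a : bounded_support B f ->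
  L w (fun x => a * f x) = a * L w f.
Proof.
move=> hf; rewrite !vector_integralE//; last exact: bounded_supportZ.
rewrite mulr_sumr/=; apply: eq_bigr => i _.
rewrite !RintegralZl//; [ring|exact: integrable_mun|exact: integrable_mup].
Qed.

Lemma vector_integral_sum w (I : Type) (r : seq I) (f : I -> 'rV[R]_n -> R) :
  (forall i, bounded_support B (f i)) ->
  L w (fun x => \sum_(i <- r) f i x) = \sum_(i <- r) L w (f i).
Proof.
move=> fB; elim: r => [|i r IH].
  rewrite big_nil; under eq_fun do rewrite big_nil -(mul0r 0).
  rewrite vector_integralZ ?mul0r//.
  by split => //; exists 0 => x; rewrite normr0.
rewrite big_cons -IH -vector_integralD//; last exact: bounded_support_sum.
by congr vector_integral; apply/funext => x; rewrite big_cons.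
Qed.

Lemma vector_integralN w f : bounded_support B f -> L (- w) f = - L w f.
Proof.
move=> hf; rewrite !vector_integralE// -sumrN; apply: eq_bigr => i _.
by rewrite mxE mulNr.
Qed.

(** For [C] inside [A], D_i(C) = D_i(A) - D_i(A \ C) is at most D_i(A) plus the negative variation
    of [A]; the supremum over [C] gives one inequality, and the same with signs exchanged the
    other. *)
Lemma jordan_decomposition i A : measurable A -> bounded_set A ->
  fine (mup i A) - fine (mun i A) = D A ord0 i.
Proof.
move=> mA bA.
have pf := vvariation_pos_fin hD i mA bA.
have nf := vvariation_pos_fin (vector_radonN hD) i mA bA.
have sub C : bounded_set (A `\` C) by exact: sub_bounded (@subDsetl _ _ _) bA.
apply/eqP; rewrite eq_le; apply/andP; split.
  rewrite lerBlDr -lee_fin EFinD [X in (X <= _)%E]fineK// [X in (_ + X)%E]fineK//.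
  apply: ge_ereal_sup => _ [C [mC bC CA] <-].
  rewrite -leeBlDl// -EFinB.
  have -> : D C ord0 i - D A ord0 i = - D (A `\` C) ord0 i.
    by rewrite (radonD hD mC mA bA CA) mxE; ring.
  have := @vvariation_pos_ge _ _ (fun A => - D A) i (A `\` C) A.
  by rewrite mxE; apply => //; exact: measurableD.
rewrite lerBrDr -lerBrDl -lee_fin EFinB [X in (X <= _)%E]fineK// [X in (X - _)%E]fineK//.
apply: ge_ereal_sup => _ [C [mC bC CA] <-].
rewrite leeBrDr// -EFinD mxE.
have -> : - D C ord0 i + D A ord0 i = D (A `\` C) ord0 i.
  by rewrite (radonD hD mC mA bA CA) mxE; ring.
by apply: vvariation_pos_ge => //; exact: measurableD.
Qed.

Lemma vector_integral_indic w A : measurable A -> A `<=` B ->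
  L w \1_A = edot w (D A).
Proof.
move=> mA AB; rewrite vector_integralE; last exact: bounded_support_indic.
apply: eq_bigr => i _; rewrite -jordan_decomposition//; last exact: sub_bounded bB.
by rewrite /Rintegral !integral_indic// !setIT.
Qed.

(** Only the linear dependence on [M] matters: a uniformly small error has a small integral. *)
Lemma normr_vector_integral_le w f M : bounded_support B f -> 0 <= M ->
  (forall x, `|f x| <= M) ->
  `|L w f| <= M * (\sum_(i < n) `|w ord0 i| * (fine (mup i B) + fine (mun i B))).
Proof.
move=> hf M0 fM; rewrite vector_integralE// mulr_sumr.
apply: le_trans (ler_norm_sum _ _ _) _; apply: ler_sum => i _.
have key (mu : {measure set 'rV[R]_n -> \bar R}) : (mu B < +oo)%E ->
    mu.-integrable setT (EFin \o f) -> `|\int[mu]_y f y| <= M * fine (mu B).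
  move=> muB intf; apply: le_trans (le_normr_Rintegral _ intf) _ => //.
  have hB : bounded_support B (fun x => M * \1_B x).
    by apply: bounded_supportZ; exact: bounded_support_indic.
  have -> : M * fine (mu B) = \int[mu]_y (M * \1_B y).
    rewrite RintegralZl//; last first.
      by apply: bounded_support_integrable muB _ => //; exact: bounded_support_indic.
    by rewrite /Rintegral integral_indic// setIT.
  apply: le_Rintegral => //; first exact: (integrable_norm intf).
    exact: bounded_support_integrable muB _.
  move=> x _; have [Bx|Bx] := pselect (B x).
    by rewrite indicE mem_set// mulr1.
  by have [_ _ ->] := hf; rewrite ?normr0// mulr_ge0.
rewrite normrM mulrCA ler_wpM2l// mulrDr.
apply: (le_trans (ler_normB _ _)); rewrite lerD//; apply: key.
- by have := vvariation_pos_fin hD i mB bB; rewrite fin_numE ltey => /andP[].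
- exact: integrable_mup.
- have := vvariation_pos_fin (vector_radonN hD) i mB bB.
  by rewrite fin_numE ltey => /andP[].
- exact: integrable_mun.
Qed.

(** Dominated convergence for each Jordan part, with dominating function [\1_B]. *)
Lemma vector_integral_cvg w (f_ : nat -> 'rV[R]_n -> R) f :
  (forall k, bounded_support B (f_ k)) -> bounded_support B f ->
  (forall k x, `|f_ k x| <= 1) ->
  (forall x, f_ ^~ x @ \oo --> f x) ->
  (fun k => L w (f_ k)) @ \oo --> L w f.
Proof.
move=> hf_ hf f_1 f_f; rewrite vector_integralE//.
under eq_fun do rewrite vector_integralE//.
have key (mu : {measure set 'rV[R]_n -> \bar R}) : (mu B < +oo)%E ->
    (fun k => \int[mu]_y f_ k y) @ \oo --> \int[mu]_y f y.
  move=> muB.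
  have intB : mu.-integrable setT (EFin \o (\1_B : _ -> R)).
    by apply: bounded_support_integrable muB _ => //; exact: bounded_support_indic.
  have [] := @dominated_convergence _ _ _ mu setT measurableT
    (fun k => EFin \o f_ k) (EFin \o f) (EFin \o \1_B).
  - by move=> k; have [/measurable_EFinP] := hf_ k.
  - by have [/measurable_EFinP] := hf.
  - by apply: aeW => x _ /=; apply: cvg_EFin => /=; [exact: nearW|exact: f_f].
  - exact: intB.
  - apply: aeW => x k _ /=; rewrite lee_fin indicE; have [Bx|Bx] := pselect (B x).
      by rewrite mem_set.
    by have [_ _ ->] := hf_ k; rewrite ?normr0.
  move=> _ _ h; apply: fine_cvg.
  rewrite fineK//; apply: integrable_fin_num => //.
  exact: bounded_support_integrable muB hf.
apply: cvg_sumr => i; apply: cvgM; first exact: cvg_cst.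
apply: cvgB; apply: key.
- by have := vvariation_pos_fin hD i mB bB; rewrite fin_numE ltey => /andP[].
- have := vvariation_pos_fin (vector_radonN hD) i mB bB.
  by rewrite fin_numE ltey => /andP[].
Qed.

End scalar_vector_integral.

(** * Layer-cake comparison and alignment defects *)

Lemma sum_ltn_bounds (R : realType) m (t : R) : 0 <= t -> t <= m%:R ->
  t <= \sum_(j < m) (j%:R < t)%R%:R <= t + 1.
Proof.
elim: m => [|m IH] t0 tm.
  by rewrite big_ord0 tm/= addr_ge0.
rewrite big_ord_recr/=; have [tm'|mt] := leP t m%:R.
  by rewrite addr0; exact: IH.
rewrite (eq_bigr (fun=> 1)) => [|j _]; last first.
  by rewrite (lt_trans _ mt)// ltr_nat.
rewrite sumr_const card_ord; rewrite -natr1 in tm.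
by rewrite tm/= lerD2r ltW.
Qed.

Section layer_cake.
Context {R : realType} {n : nat}.
Variable D : set 'rV[R]_n -> 'rV[R]_n.
Hypothesis hD : vector_radon D.
Variables (B : set 'rV[R]_n).
Hypotheses (mB : measurable B) (bB : bounded_set B).
Implicit Types (f g : 'rV[R]_n -> R) (A : set 'rV[R]_n) (w : 'rV[R]_n).

Local Notation L w f := (vector_integral D (fun y => f y *: w)).

(** The function [f] is replaced by the staircase averaging the indicators of its superlevel sets at
    the levels j / (m + 1). Each indicator contributes at most [C], and the staircase is uniformly
    within 1 / (m + 1) of [f]. *)
Lemma layer_cake_le w f C : bounded_support B f ->
  (forall x, 0 <= f x <= 1) ->
  (forall t, 0 <= t < 1 -> edot w (D [set x | t < f x]) <= C) ->
  L w f <= C.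
Proof.
move=> hf f01 fC.
set K := \sum_(i < n) `|w ord0 i| * (fine (pos_measure i hD B) +
  fine (pos_measure i (vector_radonN hD) B)).
have K0 : 0 <= K.
  by apply: sumr_ge0 => i _; rewrite mulr_ge0// addr_ge0// fine_ge0.
(* The truncation of [K / e] serves as [m], making the error [K / (m + 1)] at most [e]. *)
suff LK m : L w f <= C + m.+1%:R^-1 * K.
  apply/ler_addgt0Pr => e e0.
  apply: (le_trans (LK (Num.truncn (K / e)))); rewrite lerD2l.
  rewrite mulrC ler_pdivrMr// mulrC -ler_pdivrMr//.
  exact/ltW/truncnS_gt.
pose t j : R := j%:R / m.+1%:R.
have tle j x : (t j < f x) = (j%:R < f x * m.+1%:R).
  by rewrite /t ltr_pdivrMr.
have mA j : measurable [set x | t j < f x].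
  rewrite (_ : [set x | _] = f @^-1` `]t j, +oo[%classic).
    by rewrite -[X in measurable X]setTI; have [mf _ _] := hf; apply: mf.
  by apply/seteqP; split=> x /=; rewrite in_itv/= andbT.
have AB j : [set x | t j < f x] `<=` B.
  move=> x /= tf; apply: contrapT => Bx.
  move: tf; have [_ _ ->//] := hf; rewrite ltNge /t divr_ge0//.
pose h (j : 'I_m.+1) x : R := m.+1%:R^-1 * \1_[set x | t j < f x] x.
have hh j : bounded_support B (h j).
  by apply: bounded_supportZ; exact: bounded_support_indic.
have hsum := bounded_support_sum (index_enum 'I_m.+1) hh.
have -> : L w f = L w (fun x => \sum_(j < m.+1) h j x) +
                  L w (fun x => f x - \sum_(j < m.+1) h j x).
  rewrite -(vector_integralD hD mB bB)//; last exact: bounded_supportB.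
  by congr vector_integral; apply/funext => x; rewrite addrC subrK.
apply: lerD.
  rewrite (vector_integral_sum hD mB bB)//.
  rewrite [leRHS](_ : _ = \sum_(j < m.+1) m.+1%:R^-1 * C); last first.
    by rewrite sumr_const card_ord -[RHS]mulr_natl mulrA mulfV// mul1r.
  apply: ler_sum => j _.
  rewrite (vector_integralZ hD mB bB)//; last exact: bounded_support_indic.
  rewrite (vector_integral_indic hD mB bB)// ler_wpM2l ?invr_ge0//.
  apply: fC; rewrite /t divr_ge0//= ltr_pdivrMr// mul1r ltr_nat//.
apply: (le_trans (ler_norm _)).
apply: (normr_vector_integral_le hD mB bB); [exact: bounded_supportB|by rewrite invr_ge0|].
move=> x; have /andP[f0 f1] := f01 x.
have -> : \sum_(j < m.+1) h j x =
    m.+1%:R^-1 * \sum_(j < m.+1) (j%:R < f x * m.+1%:R)%R%:R.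
  rewrite mulr_sumr; apply: eq_bigr => j _; rewrite /h indicE -tle.
  have [tf|/negP tf] := boolP (t j < f x); first by rewrite mem_set.
  by rewrite memNset.
have m0 : 0 < m.+1%:R :> R by [].
(* The number of levels below [f x] is the ceiling of [f x * m.+1], so the staircase lies above [f],
   by at most one step. *)
have /andP[s1 s2] := @sum_ltn_bounds R m.+1 (f x * m.+1%:R)
  (mulr_ge0 f0 (ler0n _ _)) ltac:(by rewrite ler_piMl).
rewrite distrC ger0_norm; last by rewrite subr_ge0 ler_pdivlMl// mulrC.
by rewrite lerBlDr ler_pdivrMl// mulrDr mulfV// [leRHS]addrC (mulrC _ (f x)).
Qed.

Lemma layer_cake_ge w f C : bounded_support B f ->
  (forall x, 0 <= f x <= 1) ->
  (forall t, 0 <= t < 1 -> C <= edot w (D [set x | t < f x])) ->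
  C <= L w f.
Proof.
move=> hf f01 fC; rewrite -lerN2 -(vector_integralN hD mB bB)//.
by apply: layer_cake_le => // t t01; rewrite edotNl lerN2 fC.
Qed.

(* [|v - |v| u|^2 = 2 |v| (|v| - u . v)], followed by AM-GM. *)
Lemma edot_deviation_le (u v w : 'rV[R]_n) (e : R) : enorm u = 1 ->
  edot w u <= 0 -> 0 < e ->
  edot w v <= enorm w * (e * enorm v + (enorm v - edot u v) / (2 * e)).
Proof.
move=> u1 wu e0; set V := enorm v; set d := V - edot u v.
have d0 : 0 <= d.
  by rewrite subr_ge0 (le_trans (ler_norm _))// (le_trans (normr_edot_le _ _))// u1 mul1r.
have V0 : 0 <= V by exact: enorm_ge0.
have -> : edot w v = edot w (v - V *: u) + V * edot w u.
  by rewrite edotBr edotZr subrK.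
rewrite -[leRHS]addr0; apply: lerD; last by rewrite mulr_ge0_le0.
apply: (le_trans (ler_norm _)); apply: (le_trans (normr_edot_le _ _)).
rewrite ler_wpM2l ?enorm_ge0// -ler_sqr ?nnegrE ?enorm_ge0//; last first.
  by rewrite addr_ge0// ?mulr_ge0 ?invr_ge0 ?mulr_ge0// ltW.
rewrite sqr_enorm edotBl !edotBr !edotZl !edotZr -!sqr_enorm u1 (edotC v u).
rewrite -subr_ge0.
rewrite (_ : _ - _ = (e * V - d / (2 * e)) ^+ 2) ?sqr_ge0//.
by rewrite /d /V; field; rewrite gt_eqF.
Qed.

(** The defect |D(A)| - u . D(A) is at most |D|(B) - u . D(B), because the complementary piece
    [B \ A] has a nonnegative defect. Alignment on [B] is thus inherited by subsets of any shape. *)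
Lemma edot_radon_le u w e A : enorm u = 1 -> edot w u <= 0 -> 0 < e ->
  measurable A -> A `<=` B ->
  edot w (D A) <= enorm w * (e * fine (vtotal_variation D B) +
    (fine (vtotal_variation D B) - edot u (D B)) / (2 * e)).
Proof.
move=> u1 wu e0 mA AB; apply: (le_trans (edot_deviation_le _ u1 wu e0)).
rewrite ler_wpM2l ?enorm_ge0// lerD//.
  by rewrite ler_wpM2l ?(ltW e0)//; exact: enorm_variation.
rewrite ler_wpM2r ?invr_ge0 ?mulr_ge0 ?(ltW e0)//.
have := variation_ge2 D mA mB bB AB.
rewrite -(fineK (variation_fin hD mB bB)) lee_fin (radonD hD mA mB bB AB) edotDr => h.
have : edot u (D (B `\` A)) <= enorm (D (B `\` A)).
  by rewrite (le_trans (ler_norm _))// (le_trans (normr_edot_le _ _))// u1 mul1r.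
lra.
Qed.

End layer_cake.

(** * Smooth bumps *)

Section flat_function.
Context {R : realType}.
Implicit Types (P : {poly R}) (t s : R).

(* Every derivative of the flat function [exp (- 1 / t)] has this shape. *)
Definition flat P t : R := if 0 < t then P.[t^-1] * expR (- t^-1) else 0.

Lemma flat_le0 P t : t <= 0 -> flat P t = 0.
Proof. by rewrite /flat ltNge => ->. Qed.

(** Each monomial satisfies s^i <= i! exp(s), whence the constant. *)
Lemma poly_expR_bounded P :
  exists2 C, 0 <= C & forall s, 0 <= s -> `|P.[s]| * expR (- s) <= C.
Proof.
exists (\sum_(i < size P) `|P`_i| * (i`!)%:R).
  by apply: sumr_ge0 => i _; rewrite mulr_ge0.
move=> s s0; rewrite expRN ler_pdivrMr ?expR_gt0// horner_coef.
apply: (le_trans (ler_norm_sum _ _ _)); rewrite mulr_suml; apply: ler_sum => i _.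
rewrite normrM -mulrA ler_wpM2l// ger0_norm ?exprn_ge0//.
rewrite -ler_pdivrMl ?ltr0n ?fact_gt0//.
case: (nat_of_ord i) => [|k].
  by rewrite fact0 invr1 expr0 mulr1 -expR0 ler_expR.
by rewrite mulrC (le_trans _ (expR_ge1Dxn k s0))// lerDr.
Qed.

(** The previous bound, applied to ['X^2 * P] at 1 / t. A quadratic bound makes the difference
    quotients at 0 vanish in the limit. *)
Lemma flat_quadratic P : exists2 C, 0 <= C & forall t, `|flat P t| <= C * t ^+ 2.
Proof.
have [C C0 PC] := poly_expR_bounded ('X^2 * P); exists C => // t.
rewrite /flat; case: ifPn => [t0|_]; last by rewrite normr0 mulr_ge0// sqr_ge0.
have := PC t^-1; rewrite invr_ge0 (ltW t0) => /(_ isT).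
rewrite hornerM hornerXn normrM (ger0_norm (exprn_ge0 _ _)) ?invr_ge0 ?(ltW t0)//.
rewrite -mulrA exprVn ler_pdivrMl ?exprn_gt0// [leRHS]mulrC.
by rewrite normrM (ger0_norm (expR_ge0 _)).
Qed.

(** With s = 1 / t one has ds/dt = - s^2, so P(s) exp(- s) has derivative s^2 (P(s) - P'(s)) exp(-
    s). *)
Lemma is_derive_flat P t :
  is_derive t (1 : R) (flat P) (flat ('X^2 * (P - P^`())) t).
Proof.
have [t0|t0|->] := ltgtP t 0.
- rewrite flat_le0 ?(ltW t0)//; apply: (@near_eq_is_derive _ _ _ (cst 0)).
    near=> s; rewrite flat_le0//; apply: ltW; near: s; exact: lt_nbhsl.
- apply: (@near_eq_is_derive _ _ _ (fun s => P.[s^-1] * expR (- s^-1))).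
    near=> s; rewrite /flat ifT//; near: s; exact: lt_nbhsr.
  have dV : is_derive t (1 : R) (fun s : R => s^-1) (- t ^- 2).
    apply: is_derive_eq (is_deriveV _ _) _; rewrite ?gt_eqF//.
    by rewrite scaler1.
  have d1 : is_derive t (1 : R) (fun s => P.[s^-1]) (P^`().[t^-1] * - t ^- 2).
    exact: (@is_derive1_comp _ (horner P) (fun s : R => s^-1)).
  have d2 : is_derive t (1 : R) (fun s => expR (- s^-1)) (expR (- t^-1) * (- - t ^- 2)).
    by apply: (@is_derive1_comp _ expR (fun s : R => - s^-1)); exact: is_deriveN.
  apply: is_derive_eq (is_deriveM d1 d2) _.
  rewrite /flat t0 !hornerE /= exprVn; rewrite /GRing.scale/=; ring.
- rewrite flat_le0//.
  have [C C0 PC] := flat_quadratic P.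
  suff h : (fun h : R => h^-1 *: ((flat P \o shift 0) (h *: (1 : R)) - flat P 0)) @ 0^' --> (0 : R).
    by apply: DeriveDef; [apply/cvg_ex; exists 0|exact: cvg_lim].
  apply/cvgrPdist_le => e e0; near=> h.
  rewrite sub0r normrN /= (flat_le0 _ (lexx 0)) subr0 addr0 [h *: _]mulr1 /GRing.scale /=.
  have h0 : h != 0 by near: h; exact: nbhs_dnbhs_neq.
  rewrite normrM normfV ler_pdivrMl ?normr_gt0//.
  apply: (le_trans (PC h)); rewrite -real_normK ?num_real// expr2 mulrA mulrC.
  rewrite ler_wpM2l//.
  (* The constant [C] may be 0; [C + 1] can be divided by. *)
  rewrite (@le_trans _ _ ((C + 1) * `|h|))// ?ler_wpM2r ?lerDl//.
  rewrite -ler_pdivlMl ?ltr_wpDl//; near: h.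
  apply: dnbhs0_le; rewrite mulr_gt0 ?invr_gt0 ?ltr_wpDl//.
Unshelve. all: by end_near. Qed.

Lemma flat_continuous P : continuous (flat P).
Proof.
move=> t; apply/differentiable_continuous/derivable1_diffP.
by apply: ex_derive; exact: is_derive_flat.
Qed.

Lemma flat1_homo : {homo flat 1 : s t / s <= t}.
Proof.
move=> s t st; rewrite /flat !hornerE; case: ifPn => [s0|_]; last first.
  by case: ifP => // _; rewrite mul1r expR_ge0.
rewrite (lt_le_trans s0 st) ?mul1r ler_expR lerN2 lef_pV2 ?posrE//.
exact: lt_le_trans st.
Qed.

Lemma flat1_gt0 t : 0 < t -> 0 < flat 1 t.
Proof. by move=> t0; rewrite /flat t0 hornerE mul1r expR_gt0. Qed.

End flat_function.

Section line_derivative.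
Context {R : realType} {V W : normedModType R}.

(** Turns directional derivatives into derivatives of one real variable, for which the chain rule
    and the derivatives of polynomials apply. *)
Lemma is_derive_line (f : V -> W) x v df :
  is_derive x v f df <-> is_derive (0 : R) (1 : R) (fun h => f (h *: v + x)) df.
Proof.
have E : 'D_v f x = 'D_1 (fun h : R => f (h *: v + x)) 0.
  rewrite /derive; set g1 := fun h => h^-1 *: _; set g2 := fun h => h^-1 *: _.
  suff -> : g1 = g2 by [].
  by rewrite funeqE /g1 /g2 => h /=; rewrite addr0 scale0r add0r [_%:A]mulr1.
split=> -[d1 d2]; apply: DeriveDef; [|by rewrite -E| |by rewrite E].
- exact: (derivable1P _ _ _).1.
- exact: (derivable1P _ _ _).2.
Qed.

End line_derivative.

Section smooth_class.
Context {R : realType} {n : nat}.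
Implicit Types (f g : 'rV[R]_n -> R) (x c : 'rV[R]_n).

(** A class of functions containing the bumps and closed under partial derivatives, so that
    smoothness follows by induction. The flat generator ranges over all polynomials [P] because
    differentiation changes [P]. *)
Inductive bump_algebra : ('rV[R]_n -> R) -> Prop :=
| bump_algebra_cst a : bump_algebra (cst a)
| bump_algebra_coord i : bump_algebra (fun x => x ord0 i)
| bump_algebraD f g : bump_algebra f -> bump_algebra g ->
    bump_algebra (fun x => f x + g x)
| bump_algebraM f g : bump_algebra f -> bump_algebra g ->
    bump_algebra (fun x => f x * g x)
| bump_algebra_flat P c r :
    bump_algebra (fun x => flat P (r - edot (x - c) (x - c))).

Lemma continuous_edot_shift c : continuous (fun x => edot (x - c) (x - c)).
Proof.
move=> x; have h : (fun z => z - c) @ nbhs x --> x - c.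
  by apply: cvgB; [exact: cvg_id|exact: cvg_cst].
exact: (edot_cvg h h).
Qed.

Lemma bump_algebra_continuous f : bump_algebra f -> continuous f.
Proof.
elim=> {f} [a|i|f g _ cf _ cg|f g _ cf _ cg|P c r] x.
- exact: cst_continuous.
- exact: (@coord_continuous R 1 n ord0 i x).
- exact: (cvgD (cf x) (cg x)).
- exact: (cvgM (cf x) (cg x)).
- have h : (fun x => r - edot (x - c) (x - c)) @ nbhs x --> r - edot (x - c) (x - c).
    by apply: cvgB; [exact: cvg_cst|exact: continuous_edot_shift].
  exact: (cvg_comp _ (flat P) h (@flat_continuous _ P _)).
Qed.

Lemma bump_algebra_derive f i : bump_algebra f ->
  exists2 g, bump_algebra g &
    forall x, is_derive x (delta_mx ord0 i) f (g x).
Proof.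
elim=> {f} [a|j|f g af [f' af' ff'] ag [g' ag' gg']|f g af [f' af' ff'] ag [g' ag' gg']|P c r].
- by exists (cst 0); [exact: bump_algebra_cst|move=> x; exact: is_derive_cst].
- exists (cst (i == j)%:R); first exact: bump_algebra_cst.
  move=> x; apply/is_derive_line.
  have -> : (fun h : R => (h *: delta_mx ord0 i + x) ord0 j) =
      horner ((i == j)%:R *: 'X + (x ord0 j)%:P).
    by apply/funext => h; rewrite !mxE eqxx/= !hornerE eq_sym mulrC.
  apply: (is_derive_eq (is_derive_poly _ _)).
  by rewrite !poly.derivE !hornerE.
- exists (fun x => f' x + g' x); first exact: bump_algebraD.
  by move=> x; exact: (@is_deriveD _ _ _ f g).
- exists (fun x => f x * g' x + g x * f' x).
    by apply: bump_algebraD; exact: bump_algebraM.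
  by move=> x; exact: (@is_deriveM _ _ f g).
- exists (fun x => flat ('X^2 * (P - P^`())) (r - edot (x - c) (x - c)) *
                   (- 2 * (x ord0 i + - c ord0 i))).
    apply: bump_algebraM; first exact: bump_algebra_flat.
    apply: bump_algebraM; first exact: bump_algebra_cst.
    by apply: bump_algebraD; [exact: bump_algebra_coord|exact: bump_algebra_cst].
  move=> x; apply/is_derive_line.
  (* The expansion in [h] of the argument of [flat] along the i-th coordinate line through [x]; its
     derivative at 0 is -2 (x_i - c_i). *)
  pose q := (r - edot (x - c) (x - c))%:P -
    ('X^2 + (2 * (x ord0 i - c ord0 i)) *: 'X).
  have eE (v : 'rV[R]_n) : edot (delta_mx ord0 i) v = v ord0 i.
    rewrite /edot (bigD1 i)//= big1 => [|j ji]; rewrite mxE ?eqxx ?mul1r ?addr0//.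
    by rewrite (negbTE ji) andbF mul0r.
  have -> : (fun h : R => flat P (r - edot (h *: delta_mx ord0 i + x - c)
      (h *: delta_mx ord0 i + x - c))) = flat P \o horner q.
    apply/funext => h /=; congr flat; rewrite /q !hornerE/= -(addrA _ x).
    have -> : x ord0 i - c ord0 i = (x - c) ord0 i by rewrite !mxE.
    set v := x - c; rewrite edotDl !edotDr !edotZl !edotZr.
    by rewrite (edotC v (delta_mx ord0 i)) !eE !mxE !eqxx/=; ring.
  have -> : r - edot (x - c) (x - c) = q.[0].
    by rewrite /q !hornerE/= expr0n/=; ring.
  apply: is_derive1_comp; first exact: is_derive_flat.
  apply: (is_derive_eq (is_derive_poly _ _)).
  by rewrite /q !poly.derivE !hornerE/=; ring.
Qed.

Lemma smooth_bump_algebra f (w : 'rV[R]_n) : bump_algebra f ->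
  smooth (fun x => f x *: w).
Proof.
move=> af.
have dZ (g : 'rV[R]_n -> R) (g' : R) i x : is_derive x (delta_mx ord0 i) g g' ->
    is_derive x (delta_mx ord0 i) (fun x : 'rV[R]_n => g x *: w) (g' *: w).
  move=> [dg dgE]; have h : (fun h : R =>
      h^-1 *: ((fun x => g x *: w) (h *: delta_mx ord0 i + x) - g x *: w))
      @ 0^' --> g' *: w.
    have -> : (fun h : R => h^-1 *: (g (h *: delta_mx ord0 i + x) *: w - g x *: w)) =
       (fun h : R => (h^-1 *: (g (h *: delta_mx ord0 i + x) - g x)) *: w).
      by apply/funext => h; rewrite -scalerBl scalerA.
    by apply: cvgZr_tmp; rewrite -dgE; exact: dg.
  by apply: DeriveDef; [apply/cvg_ex; eexists; exact: h|apply: cvg_lim => //; exact: norm_hausdorff].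
have H s : exists2 g, bump_algebra g &
    foldr partial_derive (fun x => f x *: w) s = (fun x => g x *: w).
  elim: s => [|i s [g ag IH]]; first by exists f.
  have [g' ag' gg'] := bump_algebra_derive i ag; exists g' => //=.
  rewrite IH; apply/funext => x; rewrite /partial_derive.
  by have [_ ->] := dZ _ _ _ _ (gg' x).
move=> s; have [g ag ->] := H s; split.
  have cg := bump_algebra_continuous ag.
  by move=> x; exact: (@cvgZr_tmp _ _ _ (nbhs (x : 'rV[R]_n)) _ g (g x) w (cg x)).
move=> i x; have [g' ag' gg'] := bump_algebra_derive i ag.
by have [] := dZ _ _ _ _ (gg' x).
Qed.

End smooth_class.

Section bumps.
Context {R : realType} {n : nat}.
Implicit Types (c x w : 'rV[R]_n) (r t : R).

(** The division normalizes the value at the center to 1; the bump is positive exactly on the open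
    ball when [r] is positive. *)
Definition bump c r x : R := flat 1 (r ^+ 2 - edot (x - c) (x - c)) / flat 1 (r ^+ 2).

Lemma eball_edot c r x : 0 < r ->
  eball c r x <-> 0 < r ^+ 2 - edot (x - c) (x - c).
Proof.
move=> r0; rewrite /eball/= subr_gt0 -sqr_enorm.
by rewrite ltr_sqr ?nnegrE ?enorm_ge0// ltW.
Qed.

Lemma bump_out c r x : 0 < r -> ~ eball c r x -> bump c r x = 0.
Proof.
move=> r0 /(eball_edot _ _ r0)/negP; rewrite -leNgt => h.
by rewrite /bump flat_le0// mul0r.
Qed.

Lemma bump_gt0 c r x : 0 < r -> eball c r x -> 0 < bump c r x.
Proof.
by move=> r0 /(eball_edot _ _ r0) h; rewrite divr_gt0 ?flat1_gt0// exprn_gt0.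
Qed.

Lemma bump_ge0 c r x : 0 < r -> 0 <= bump c r x.
Proof.
move=> r0; have [h|h] := pselect (eball c r x); first exact/ltW/bump_gt0.
by rewrite bump_out.
Qed.

Lemma bump_le1 c r x : 0 < r -> bump c r x <= 1.
Proof.
move=> r0; rewrite ler_pdivrMr ?flat1_gt0 ?exprn_gt0// mul1r.
by apply: flat1_homo; rewrite lerBlDr lerDl edot_ge0.
Qed.

(* The radius comes from inverting [exp (- 1 / (r^2 - q)) = t exp (- 1 / r^2)]
   in [q]. *)
Lemma bump_level c r t : 0 < r -> 0 < t < 1 ->
  exists2 s, 0 < s < r & [set x | t < bump c r x] = eball c s.
Proof.
move=> r0 /andP[t0 t1]; have r20 : 0 < r ^+ 2 by rewrite exprn_gt0.
set K := r ^- 2 - ln t.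
have Kr : r ^- 2 < K by rewrite ltrDl oppr_gt0 ln_lt0// t0 t1.
have K0 : 0 < K by rewrite (lt_trans _ Kr)// invr_gt0.
have Kr2 : K^-1 < r ^+ 2 by rewrite -[ltRHS]invrK ltf_pV2 ?posrE ?invr_gt0.
have s0 : 0 < r ^+ 2 - K^-1 by rewrite subr_gt0.
exists (Num.sqrt (r ^+ 2 - K^-1)).
  rewrite sqrtr_gt0 s0/= -[ltRHS]ger0_norm ?(ltW r0)// -sqrtr_sqr.
  by rewrite ltr_sqrt// ltrBlDr ltrDl invr_gt0.
have lev x : (t < bump c r x) = (K^-1 < r ^+ 2 - edot (x - c) (x - c)).
  rewrite ltr_pdivlMr ?flat1_gt0//.
  rewrite /flat !hornerE r20 ?mul1r; case: ifPn => [q0|].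
    rewrite ?mul1r -[X in X * _](@lnK _ t) ?posrE// -expRD ltr_expR.
    rewrite ltrNr opprD opprK (addrC (- ln t)) -/K.
    by rewrite -[in LHS](invrK K) ltf_pV2 ?posrE ?invr_gt0.
  rewrite -leNgt => q0; rewrite ltNge mulr_ge0 ?expR_ge0 ?(ltW t0)//=.
  by apply/esym/negbTE; rewrite -leNgt (le_trans q0)// invr_ge0 ltW.
apply/seteqP; split=> x; rewrite /eball /= lev.
  move=> h; rewrite /enorm ltr_sqrt//; lra.
rewrite /enorm ltr_sqrt//; lra.
Qed.

(** Smooth approximations of the indicator of the ball: inside, [1 - bump] lies in [0, 1), so its
    powers tend to 0; outside, the value is 0 for every [j]. *)
Definition bumpn c r j x : R := 1 - (1 - bump c r x) ^+ j.

Lemma bump_algebra_bump c r : bump_algebra (bump c r).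
Proof.
have h1 := @bump_algebra_flat R n 1 c (r ^+ 2).
exact: (bump_algebraM h1 (@bump_algebra_cst R n (flat 1 (r ^+ 2))^-1)).
Qed.

Lemma bump_algebra_bumpn c r j : bump_algebra (bumpn c r j).
Proof.
have aB f : bump_algebra f -> bump_algebra (fun x => 1 - f x).
  move=> af; have := bump_algebraD (@bump_algebra_cst R n 1)
    (bump_algebraM (@bump_algebra_cst R n (- 1)) af).
  by congr bump_algebra; apply/funext => x; rewrite mulN1r.
apply: (aB (fun x => (1 - bump c r x) ^+ j)).
elim: j => [|j IH]; first exact: (@bump_algebra_cst R n 1).
under eq_fun do rewrite exprS.
by apply: bump_algebraM => //; apply/aB/bump_algebra_bump.
Qed.

Lemma bumpn1 c r : bumpn c r 1 = bump c r.
Proof. by apply/funext => x; rewrite /bumpn expr1 opprB addrC subrK. Qed.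

Lemma bumpn_ge0_le1 c r j x : 0 < r -> 0 <= bumpn c r j x <= 1.
Proof.
move=> r0; rewrite /bumpn; have b0 := bump_ge0 c x r0; have b1 := bump_le1 c x r0.
have h0 : 0 <= 1 - bump c r x by rewrite subr_ge0.
rewrite lerBlDr lerDl exprn_ge0// andbT subr_ge0.
by rewrite exprn_ile1// lerBlDr lerDl.
Qed.

Lemma bumpn_out c r j x : 0 < r -> ~ eball c r x -> bumpn c r j x = 0.
Proof.
by move=> r0 /(bump_out r0) b0; rewrite /bumpn b0 subr0 expr1n subrr.
Qed.

Lemma bumpn_cvg c r x : 0 < r ->
  (fun j => bumpn c r j x) @ \oo --> (\1_(eball c r) x : R).
Proof.
move=> r0; have [xc|xc] := pselect (eball c r x); last first.
  rewrite indicE memNset//; under eq_fun do rewrite bumpn_out//.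
  exact: cvg_cst.
rewrite indicE mem_set// -[1%:R]subr0; apply: cvgB; first exact: cvg_cst.
apply: cvg_expr; have b0 := bump_gt0 r0 xc; have b1 := bump_le1 c x r0.
by rewrite ger0_norm ?subr_ge0// ltrBlDr ltrDl.
Qed.

Lemma bounded_support_bumpn c r j : 0 < r ->
  bounded_support (eball c r) (bumpn c r j).
Proof.
move=> r0; split; last by move=> x; exact: bumpn_out.
  exact: continuous_measurable_row (bump_algebra_continuous (bump_algebra_bumpn _ _ _)).
by exists 1 => x; have /andP[b0 b1] := bumpn_ge0_le1 c j x r0; rewrite ger0_norm.
Qed.

Lemma compact_closure_bounded (A : set 'rV[R]_n) : bounded_set A ->
  compact (closure A).
Proof.
move=> /bounded_setP[M AM]; apply: bounded_closed_compact; last exact: closed_closure.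
apply/bounded_setP; exists M.
have cM : closed [set x : 'rV[R]_n | `|x| <= M].
  apply: (@preimage_closed _ _ (fun x : 'rV[R]_n => `|x|) [set t | t <= M]); last exact: closed_le.
  by move=> x _; exact: norm_continuous.
move=> x /(closureS (AM : A `<=` [set x | `|x| <= M])).
by rewrite -(closure_id _).1.
Qed.

Lemma test_field_bumpn c r j w : 0 < r ->
  test_field setT (fun x => bumpn c r j x *: w).
Proof.
move=> r0; split=> //; first exact/smooth_bump_algebra/bump_algebra_bumpn.
apply: compact_closure_bounded; apply: sub_bounded (bounded_eball c r).
move=> x /=; apply: contra_neqP => xc.
by rewrite bumpn_out// scale0r.
Qed.

End bumps.

(** Bundles a rescaled image measure as a measure, the form in which the uniqueness of Lebesgue
    measure can be applied to it. *)
Lemma scaled_image_measure d1 d2 (X : measurableType d1) (Y : measurableType d2)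
    (R : realType) (phi : X -> Y) (k : R) (mu : {measure set X -> \bar R}) :
  measurable_fun setT phi -> 0 <= k ->
  exists m : {measure set Y -> \bar R},
    forall A, m A = (k%:E * mu (phi @^-1` A))%E.
Proof.
move=> mphi k0.
by unshelve eexists (mscale (NngNum k0) (pushforward mu phi)).
Qed.

(** * The fractional divergence of test fields *)

Section affine_change_of_variables.
Context {R : realType}.

Definition affine n (r : R) (x y : 'rV[R]_n) : 'rV[R]_n := r^-1 *: (y - x).

Lemma measurable_affine n r (x : 'rV[R]_n) : measurable_fun setT (affine r x).
Proof. by apply: measurable_rowZ; apply: measurable_rowD. Qed.

Lemma measurable_affine1 (r a : R) :
  measurable_fun [set: measurableTypeR R] (fun t : measurableTypeR R => r^-1 * (t - a) : measurableTypeR R).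
Proof. by apply: measurable_funM => //; exact: measurable_funB. Qed.

(** The image of Lebesgue measure under the map, divided by [r], agrees with Lebesgue measure on
    half-open intervals, hence everywhere by uniqueness. *)
Lemma lebesgue_measure_affine (r a : R) (A : set (measurableTypeR R)) :
  0 < r -> measurable A ->
  lebesgue_measure ((fun t => r^-1 * (t - a)) @^-1` A) =
  (r%:E * lebesgue_measure A)%E.
Proof.
move=> r0 mA.
have ri0 : 0 <= r^-1 by rewrite invr_ge0 ltW.
have [m mE] := scaled_image_measure (@lebesgue_measure R) (measurable_affine1 r a) ri0.
rewrite (@lebesgue_measure_unique R m _ A mA).
  by rewrite mE muleA -EFinM mulfV ?gt_eqF// mul1e.
move=> _ [[u v] _ <-]; rewrite mE /=.
have -> : (fun t => r^-1 * (t - a)) @^-1` [set` `]u, v]] =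
    [set` `]r * u + a, r * v + a]].
  apply/seteqP; split=> t /=; rewrite !in_itv/= ltr_pdivlMl// ler_pdivrMl//;
    by rewrite ltrBrDr lerBlDr.
rewrite !lebesgue_measure_itv/= !lte_fin ltrD2r ltr_pM2l//.
case: ifPn => // _; last by rewrite mule0.
by rewrite -!EFinB -EFinM; congr EFin; field; rewrite gt_eqF.
Qed.

Lemma row_affine n r (x : 'rV[R]_n.+1) (p : measurableTypeR R * 'rV[R]_n) :
  affine r x (row_cons p) =
  row_cons (r^-1 * (p.1 - x ord0 ord0), affine r (row_tail x) p.2).
Proof.
apply/rowP => i; case: (split_ordP (i : 'I_(1 + n))) => j {i}->.
  rewrite /affine mxE mxE /row_cons (@row_mxEl _ 1 1 n) mxE mxE (@row_mxEl _ 1 1 n) mxE.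
  by rewrite (_ : lshift n j = ord0)//; apply/val_inj; rewrite /= ord1.
by rewrite /affine mxE mxE /row_cons !(@row_mxEr _ 1 1 n) !mxE.
Qed.

(** Induction on the dimension: slices over the first coordinate scale by the induction hypothesis,
    and the remaining integral by the one-dimensional case. *)
Lemma lebesgue_row_affine n (r : R) (x : 'rV[R]_n) (A : set 'rV[R]_n) :
  0 < r -> measurable A ->
  lebesgue_row n (affine r x @^-1` A) = ((r ^+ n)%:E * lebesgue_row n A)%E.
Proof.
move=> r0; elim: n x A => [|n IH] x A mA.
  rewrite expr0 mul1e; congr (lebesgue_row 0 _).
  have aE y : affine r x y = y by apply/rowP => -[].
  by apply/seteqP; split => y /=; rewrite aE.
have mcons (B : set 'rV[R]_n.+1) : measurable B -> measurable (@row_cons R n @^-1` B).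
  by move=> mB; rewrite -[X in measurable X]setTI; exact: measurable_row_cons.
pose g s := lebesgue_row n (xsection (@row_cons R n @^-1` A) s).
have mg : measurable_fun setT g by apply: measurable_fun_xsection; exact: mcons.
have ri0 : 0 <= r by exact: ltW.
rewrite /= /lebesgue_row_step /pushforward /product_measure1.
transitivity (\int[@lebesgue_measure R]_t ((r ^+ n)%:E * g (r^-1 * (t - x ord0 ord0))%R))%E.
  apply: eq_integral => t _; rewrite /g -(IH (row_tail x)); last by apply: measurable_xsection; exact: mcons.
  congr (lebesgue_row n _); apply/seteqP; split => z; rewrite /xsection /= !inE/= row_affine//.
rewrite ge0_integralZl//; last 2 first.
- exact: measurableT_comp mg (measurable_affine1 r _).
- by rewrite lee_fin exprn_ge0.
rewrite exprS -[in RHS]mulrC EFinM -muleA; congr (_ * _)%E.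
rewrite -(@ge0_integral_pushforward _ _ _ _ _ _ 
  (measurable_affine1 r (x ord0 ord0)) lebesgue_measure setT g)//.
rewrite -(@ge0_integral_mscale _ _ _ lebesgue_measure _ _ (NngNum ri0))//.
apply: eq_measure_integral; first exact: measurable_affine1.
by move=> ? B mB _; exact: lebesgue_measure_affine.
Qed.

Lemma ge0_integral_affine n (r : R) (x : 'rV[R]_n) (f : 'rV[R]_n -> \bar R) :
  0 < r -> measurable_fun setT f -> (forall y, 0 <= f y)%E ->
  (\int[lebesgue_row n]_y f (affine r x y) =
   (r ^+ n)%:E * \int[lebesgue_row n]_y f y)%E.
Proof.
move=> r0 mf f0; have rn0 : 0 <= r ^+ n by rewrite exprn_ge0// ltW.
have := @ge0_integral_pushforward _ _ _ _ R _ (measurable_affine r x)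
  (lebesgue_row n) setT f measurableT mf (fun y _ => f0 y).
rewrite preimage_setT => <-.
rewrite -(@ge0_integral_mscale _ _ _ (lebesgue_row n) _ measurableT (NngNum rn0))//.
apply: eq_measure_integral; first exact: measurable_affine.
by move=> ? B mB _; exact: lebesgue_row_affine.
Qed.

(** Integrability is not assumed: the positive and negative parts are scaled separately. *)
Lemma Rintegral_affine n (r : R) (x : 'rV[R]_n) (f : 'rV[R]_n -> R) :
  0 < r -> measurable_fun setT f ->
  \int[lebesgue_row n]_y f (affine r x y) = r ^+ n * \int[lebesgue_row n]_y f y.
Proof.
move=> r0 mf; have rn0 : 0 < r ^+ n by rewrite exprn_gt0.
rewrite /Rintegral integralE [in RHS]integralE.
have fp y : ((fun y => (f (affine r x y))%:E)^\+ y =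
    (fun y => (f y)%:E)^\+ (affine r x y))%E by rewrite !funepos.unlock.
have fn y : ((fun y => (f (affine r x y))%:E)^\- y =
    (fun y => (f y)%:E)^\- (affine r x y))%E by rewrite !funeneg.unlock.
have mfE : measurable_fun setT (fun y => (f y)%:E) by exact/measurable_EFinP.
rewrite (eq_integral _ _ (fun y _ => fp y)) (eq_integral _ _ (fun y _ => fn y)).
rewrite (ge0_integral_affine x r0 (measurable_funepos mfE))//.
rewrite (ge0_integral_affine x r0 (measurable_funeneg mfE))//.
pose a := (\int[lebesgue_row n]_y (fun y => (f y)%:E)^\+ y)%E.
pose b := (\int[lebesgue_row n]_y (fun y => (f y)%:E)^\- y)%E.
rewrite -[X in _ = _ * fine X]/(a - b)%E -[X in (_ * X - _)%E]/a -[X in (_ - _ * X)%E]/b.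
have : (0 <= a)%E by apply: integral_ge0.
have : (0 <= b)%E by apply: integral_ge0.
(* A positive factor preserves infinite values, which [fine] sends to 0 on both sides. *)
case: (a) => [a'| |]; case: (b) => [b'| |] //= _ _.
all: rewrite ?gt0_muley ?lte_fin//= ?mulrBr ?mulr0//.
Qed.

End affine_change_of_variables.

Lemma bounded_derive_lipschitz (R : realType) (f df : R -> R) M a b :
  (forall t, is_derive t (1 : R) f (df t)) -> (forall t, `|df t| <= M) ->
  `|f b - f a| <= M * `|b - a|.
Proof.
move=> fdf dfM; wlog ab : a b / a <= b => [H|].
  have [/H //|/ltW/H] := leP a b.
  by rewrite distrC (distrC a).
have cf : continuous f.
  by move=> t; apply/differentiable_continuous/derivable1_diffP; apply: ex_derive.
have [c _ ->] := MVT_segment ab (fun t _ => fdf t) (continuous_subspaceT cf).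
by rewrite normrM ler_wpM2r.
Qed.

Section test_field_lipschitz.
Context {R : realType} {n : nat}.
Implicit Types (phi : 'rV[R]_n -> 'rV[R]_n) (x z : 'rV[R]_n).

Lemma is_derive_shift_line phi x v t k df :
  is_derive (t *: v + x) v phi df ->
  is_derive t (1 : R) (fun s => phi (s *: v + x) ord0 k) (df ord0 k).
Proof.
move=> [d1 d2].
have h : (fun h : R => h^-1 *: ((phi \o shift (t *: v + x)) (h *: v) - phi (t *: v + x))) @ 0^' --> df.
  by rewrite -d2; exact: d1.
have {}h : (fun h : R => h^-1 *: (((fun s : R => phi (s *: v + x) ord0 k) \o shift t) (h *: (1 : R)) -
    phi (t *: v + x) ord0 k)) @ 0^' --> df ord0 k.
  rewrite [X in X @ _](_ : _ = fun h : R =>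
    (h^-1 *: ((phi \o shift (t *: v + x)) (h *: v) - phi (t *: v + x))) ord0 k).
    exact: coord_cvg h.
  by apply/funext => s /=; rewrite !mxE/= [s *: 1]mulr1 scalerDl addrA.
by apply: DeriveDef; [apply/cvg_ex; eexists; exact: h|exact: cvg_lim].
Qed.

Lemma test_field_bounded phi : test_field setT phi ->
  exists2 M, 0 <= M & forall x, `|phi x| <= M.
Proof.
move=> [/(_ [::])[/= cphi _] cK _].
have [M [_ KM]] := compact_bounded (continuous_compact (continuous_subspaceT cphi) cK).
exists (`|M| + 1); first by rewrite addr_ge0.
move=> x; have [->|x0] := eqVneq (phi x) 0; first by rewrite normr0 addr_ge0.
apply: KM; first by rewrite ltr_pwDr// ler_norm.
by exists x => //; exact: subset_closure.
Qed.

Lemma test_field_support phi : test_field setT phi ->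
  exists2 r, 0 < r & forall x, ~ eball 0 r x -> phi x = 0.
Proof.
move=> [_ /compact_bounded/bounded_sub_eball[r r0 Kr] _]; exists r => // x.
by apply: contra_notP => /eqP x0; apply: Kr; exact: subset_closure.
Qed.

Lemma test_field_partial_bounded phi : test_field setT phi ->
  exists2 M, 0 <= M & forall i x, `|partial_derive i phi x| <= M.
Proof.
move=> [sphi cK _].
have H i : exists M, 0 <= M /\ forall x, `|partial_derive i phi x| <= M.
  have [/= cphi _] := sphi [:: i].
  have [M [_ KM]] := compact_bounded (continuous_compact (continuous_subspaceT cphi) cK).
  exists (`|M| + 1); split; first by rewrite addr_ge0.
  move=> x; have [xK|xK] := pselect (closure [set x | phi x != 0] x).
    by apply: KM; [rewrite ltr_pwDr// ler_norm|exists x].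
  rewrite (_ : partial_derive i phi x = 0) ?normr0 ?addr_ge0//.
  (* Off the closed support the field vanishes on a whole neighborhood, hence so do its
     derivatives. *)
  have : \near x, cst 0 x = phi x.
    have : nbhs x (~` closure [set x | phi x != 0]).
      by apply: open_nbhs_nbhs; split => //; exact/closed_openC/closed_closure.
    apply: filterS => y /= yK; apply/esym/eqP/negPn/negP => y0.
    by apply: yK; exact: subset_closure.
  by rewrite /partial_derive => /near_eq_derive <-; rewrite derive_cst.
pose M i := sval (cid (H i)); exists (\sum_i M i).
  by apply: sumr_ge0 => i _; rewrite /M; case: cid => ? [].
move=> i x; rewrite (bigD1 i)//=.
have Mi : `|partial_derive i phi x| <= M i by rewrite /M; case: cid => ? [].
rewrite (le_trans Mi)// lerDl; apply: sumr_ge0 => j _.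
by rewrite /M; case: cid => ? [].
Qed.

(** The displacement is split into coordinate steps, each handled by the mean value theorem. One
    factor [n] comes from summing the steps, the other from comparing the Euclidean and sup
    norms. *)
Lemma test_field_lipschitz phi : test_field setT phi ->
  exists2 L, 0 <= L & forall x z, enorm (phi (z + x) - phi x) <= L * enorm z.
Proof.
move=> tphi; have [M M0 phiM] := test_field_partial_bounded tphi.
have [/(_ [::])[/= _ dphi] _ _] := tphi.
have step i t x k : `|phi (t *: delta_mx ord0 i + x) ord0 k - phi x ord0 k| <= M * `|t|.
  pose f s := phi (s *: delta_mx ord0 i + x) ord0 k.
  have := @bounded_derive_lipschitz R f
    (fun s => partial_derive i phi (s *: delta_mx ord0 i + x) ord0 k) M 0 t.
  rewrite subr0 (_ : f 0 = phi x ord0 k); last by rewrite /f scale0r add0r.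
  apply.
    by move=> s; apply: is_derive_shift_line; apply: derivableP; exact: dphi.
  by move=> s; apply: le_trans (phiM i _); exact: coord_le_norm.
have sumstep (r : seq 'I_n) (u x : 'rV[R]_n) k :
    `|phi (\sum_(i <- r) u ord0 i *: delta_mx ord0 i + x) ord0 k - phi x ord0 k| <=
    \sum_(i <- r) M * `|u ord0 i|.
  elim: r x => [|i r IH] x; first by rewrite !big_nil add0r subrr normr0.
  rewrite !big_cons -addrA.
  set y := \sum_(j <- r) _ + x.
  rewrite -(subrK (phi y ord0 k) (phi (_ + y) ord0 k)) -addrA.
  apply: (le_trans (ler_normD _ _)); apply: lerD; first exact: step.
  exact: IH.
exists (n%:R * (n%:R * M)); first by rewrite !mulr_ge0.
move=> x z; apply: (le_trans (enorm_le_norm _)); rewrite -mulrA ler_wpM2l//.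
apply: norm_le => [|k]; first by rewrite !mulr_ge0// enorm_ge0.
rewrite !mxE [z in phi (z + x)]row_sum_delta.
apply: (le_trans (sumstep _ _ _ _)).
rewrite -mulrA mulr_natl -[X in _ *+ X]card_ord -sumr_const; apply: ler_sum => i _.
by rewrite ler_wpM2l// coord_le_enorm.
Qed.

End test_field_lipschitz.

Section bounded_finite.
Context {R : realType}.

Definition row_box n (M : R) : set 'rV[R]_n :=
  [set v | forall i, `|v ord0 i| <= M].

Lemma measurable_row_box n M : measurable (@row_box n M).
Proof.
have -> : @row_box n M = \bigcap_(i in [set: 'I_n])
    ((fun v => v ord0 i) @^-1` `[- M, M]%classic).
  apply/seteqP; split => v /= h i //; rewrite /= ?in_itv/= -?ler_norml//.
  by have := h i I; rewrite /= in_itv/= -ler_norml.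
apply: fin_bigcap_measurable => // i _.
by rewrite -[X in measurable X]setTI; apply: measurable_coord.
Qed.

Lemma lebesgue_row_box n M : (lebesgue_row n (@row_box n M) < +oo)%E.
Proof.
elim: n => [|n IH]; first by rewrite /= /lebesgue_row0 diracE ltry.
rewrite /= /lebesgue_row_step /pushforward.
rewrite (_ : _ @^-1` _ = `[- M, M]%classic `*` @row_box n M).
  rewrite product_measure1E//; last exact: measurable_row_box.
  apply: lte_mul_pinfty => //.
    by rewrite [X in X \is a fin_num]lebesgue_measure_itv/=; case: ifP.
apply/seteqP; split=> -[a v] /=; rewrite in_itv/= -ler_norml.
  move=> h; split.
    have E : row_cons (a, v) ord0 ord0 = a by have [] := row_consK (a, v).
    by have := h ord0; rewrite E.
  by move=> i; have := h (rshift 1 i); rewrite /row_cons (@row_mxEr _ 1 1 n).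
move=> [ha hv] i; case: (split_ordP (i : 'I_(1 + n))) => j {i}->.
  by rewrite /row_cons (@row_mxEl _ 1 1 n) mxE.
by rewrite /row_cons (@row_mxEr _ 1 1 n).
Qed.

Lemma lebesgue_row_bounded n (A : set 'rV[R]_n) :
  measurable A -> bounded_set A -> (lebesgue_row n A < +oo)%E.
Proof.
move=> mA /bounded_setP[M AM]; apply: le_lt_trans (lebesgue_row_box n M).
apply: le_measure; rewrite ?inE//; first exact: measurable_row_box.
by move=> v Av i; rewrite (le_trans (coord_le_norm _ _))// AM.
Qed.

Lemma lebesgue_row_eball n (r : R) : 0 < r ->
  lebesgue_row n (eball 0 r) = ((r ^+ n)%:E * lebesgue_row n (eball 0 1))%E.
Proof.
move=> r0; rewrite -(@lebesgue_row_affine _ _ _ 0)//; last exact: measurable_eball.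
congr (lebesgue_row n _); apply/seteqP; split => y; rewrite /eball /affine /= !subr0 enormZ.
  by rewrite ger0_norm ?invr_ge0 ?(ltW r0)// ltr_pdivrMl// mulr1.
by rewrite ger0_norm ?invr_ge0 ?(ltW r0)// ltr_pdivrMl// mulr1.
Qed.

End bounded_finite.

(** * Integrability of the singular kernel *)

Section singular_kernel.
Context {R : realType} {n : nat}.
Implicit Types (z : 'rV[R]_n).

(** A stand-in for polar coordinates: [K] is dominated by the sum of c_k times the indicators of
    balls of radius rho_k, whose integrals are bounded by a convergent geometric series. *)
Lemma ball_cover_integral_lty (K : 'rV[R]_n -> R) (S : set 'rV[R]_n)
    (c rho : nat -> R) C q :
  measurable S -> measurable_fun setT K -> (forall z, 0 <= K z) ->
  0 <= C -> 0 < q -> q < 1 -> (forall k, 0 <= c k) -> (forall k, 0 < rho k) ->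
  (forall k, c k * rho k ^+ n <= C * q ^+ k) ->
  (forall z, S z -> exists2 k, eball 0 (rho k) z & K z <= c k) ->
  (\int[lebesgue_row n]_(z in S) (K z)%:E < +oo)%E.
Proof.
move=> mS mK K0 C0 q0 q1 c0 rho0 cq SK.
pose f k z : \bar R := (c k * \1_(eball 0 (rho k)) z)%:E.
have f0 k z : (0 <= f k z)%E by rewrite lee_fin mulr_ge0.
have mf k : measurable_fun setT (f k).
  by apply/measurable_EFinP/measurable_funM => //; apply: measurable_indic; exact: measurable_eball.
set v := lebesgue_row n (eball (0 : 'rV[R]_n) 1).
have vfin : v \is a fin_num.
  rewrite /v ge0_fin_numE//; apply: lebesgue_row_bounded; first exact: measurable_eball.
  exact: bounded_eball.
have intf k : (\int[lebesgue_row n]_(z in S) f k z <= (C * fine v * q ^+ k)%:E)%E.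
  apply: (@le_trans _ _ (\int[lebesgue_row n]_z f k z)%E).
    by apply: ge0_subset_integral => //.
  rewrite /f; under eq_integral do rewrite EFinM.
  have mI : measurable_fun setT (fun z : 'rV[R]_n => (\1_(eball 0 (rho k)) z)%:E : \bar R).
    by apply/measurable_EFinP; apply: measurable_indic; exact: measurable_eball.
  rewrite ge0_integralZl ?lee_fin//.
  rewrite integral_indic//; last exact: measurable_eball.
  rewrite setIT.
  apply: (@le_trans _ _ ((c k)%:E * ((rho k ^+ n)%:E * v))%E).
    rewrite le_eqVlt; apply/orP; left; apply/eqP.
    by congr (_ * _)%E; exact: lebesgue_row_eball.
  rewrite -{1}(fineK vfin) -!EFinM lee_fin mulrA [leRHS]mulrAC.
  by apply: ler_wpM2r; [exact/fine_ge0/measure_ge0|exact: cq].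
apply: (@le_lt_trans _ _ (\int[lebesgue_row n]_(z in S) \sum_(k <oo) f k z)%E).
  have mKE : measurable_fun S (fun z => (K z)%:E).
    by apply: measurable_funTS; exact/measurable_EFinP.
  apply: ge0_le_integral => //.
  - by move=> z _; rewrite lee_fin.
  - apply: ge0_emeasurable_sum => //.
    by move=> k _; exact: measurable_funTS.
  move=> z /SK[k zk Kc]; apply: (@le_trans _ _ (f k z)).
    by rewrite /f lee_fin indicE mem_set// mulr1.
  apply: le_trans (@nneseries_lim_ge _ _ _ _ k.+1 _) => //.
  rewrite big_nat_recr//= leeDr//; apply: sume_ge0 => *; exact: f0.
rewrite integral_nneseries//; last by move=> k; exact: measurable_funTS.
apply: (@le_lt_trans _ _ (C * fine v / (1 - q))%:E); last by rewrite ltry.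
apply: lime_le.
  by apply: is_cvg_nneseries => k _ _; exact: integral_ge0.
apply: nearW => k.
apply: (@le_trans _ _ (\sum_(0 <= j < k) (C * fine v * q ^+ j)%:E)%E).
  by apply: lee_sum => j _; exact: intf.
rewrite sumEFin lee_fin.
have := @geometric_le_lim R k (C * fine v) q; rewrite /series /geometric/=; apply => //.
- by apply: mulr_ge0 => //; exact/fine_ge0/measure_ge0.
- by rewrite ger0_norm// ltW.
Qed.

(** The minimum merges two bounds on the increments of a test field: Lipschitz for small [z],
    uniform for large [z]. It makes the kernel behave like |z|^(1 - n - a) near 0 and |z|^(- n - a)
    at infinity, so both ends are integrable when 0 < a < 1. *)
Definition frac_kernel (a : R) z : R :=
  Num.min 1 (enorm z) / enorm z `^ (n%:R + a).

Lemma frac_kernel_ge0 a z : 0 <= frac_kernel a z.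
Proof. by rewrite divr_ge0 ?powR_ge0// le_min ler01 enorm_ge0. Qed.

Lemma measurable_frac_kernel a : measurable_fun setT (frac_kernel a).
Proof.
have me : measurable_fun setT (@enorm R n) by exact: measurable_enorm.
rewrite /frac_kernel; under eq_fun do rewrite -powRN.
apply: measurable_funM; first exact: measurable_minr.
exact: (measurableT_comp (@measurable_powR R (- (n%:R + a))) me).
Qed.

Lemma dyadic_small (s : R) : 0 < s < 1 ->
  exists k : nat, 2^-1 ^+ k.+1 <= s < 2^-1 ^+ k.
Proof.
move=> /andP[s0 s1].
have ex : exists k, 2^-1 ^+ k.+1 <= s.
  have h : `|2^-1 : R| < 1 by rewrite ger0_norm// invf_lt1// ltr1n.
  have /cvgrPdist_lt/(_ s s0) := cvg_expr h.
  move=> [k _ /(_ k.+1) /(_ (leqnSn k))]; rewrite sub0r normrN.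
  by rewrite ger0_norm ?exprn_ge0// => /ltW; exists k.
case: (ex_minnP ex) => k ks kmin; exists k; rewrite ks/=.
case: k ks kmin => [|k] ks kmin; first by rewrite expr0.
by rewrite ltNge; apply/negP => /kmin; rewrite ltnn.
Qed.

Lemma dyadic_large (s : R) : 1 <= s -> exists k : nat, 2 ^+ k <= s < 2 ^+ k.+1.
Proof.
move=> s1.
have ex : exists k, s < 2 ^+ k.+1.
  exists (Num.truncn s); apply: (lt_trans (truncnS_gt s)).
  by rewrite -natrX ltr_nat ltn_expl.
case: (ex_minnP ex) => k ks kmin; exists k; rewrite ks andbT.
case: k ks kmin => [|k] ks kmin; first by rewrite expr0.
by rewrite leNgt; apply/negP => /kmin; rewrite ltnn.
Qed.

Lemma frac_kernel_integral_lty (a : R) : 0 < a < 1 ->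
  (\int[lebesgue_row n]_z (frac_kernel a z)%:E < +oo)%E.
Proof.
move=> /andP[a0 a1].
have na0 : 0 <= n%:R + a by rewrite addr_ge0// ltW.
have h0 : 0 < 2^-1 :> R by [].
have h1 : 2^-1 <= 1 :> R by rewrite invf_le1// ler1n.
have mB : measurable (eball (0 : 'rV[R]_n) 1) by exact: measurable_eball.
have mBC := measurableC mB.
have := @ge0_integral_setU _ _ _ (lebesgue_row n) _ _ mB mBC (EFin \o frac_kernel a).
rewrite setUv => ->; last 3 first.
- by apply/measurable_EFinP; exact: measurable_frac_kernel.
- by move=> z _; rewrite lee_fin frac_kernel_ge0.
- by apply/disj_setPS; rewrite setICr.
have hlt1 : (2^-1 : R) `^ (1 - a) < 1.
  rewrite -[ltRHS](congr1 (fun f => f (1 - a)) (powR1 R)).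
  by rewrite gt0_ltr_powR ?nnegrE ?subr_gt0// ?invf_lt1// ltr1n.
apply: lte_add_pinfty.
  (* Inside the unit ball: on the annulus u_k <= |z| < 2 u_k the numerator is at most 2 u_k, and the
     ratio of the geometric series is 2^(-(1 - a)). *)
  pose u k : R := 2^-1 ^+ k.+1.
  have u0 k : 0 < u k by rewrite exprn_gt0.
  apply: (@ball_cover_integral_lty _ _ (fun k => 2 * u k / u k `^ (n%:R + a))
    (fun k => 2 * u k) (2 ^+ n.+1) (2^-1 `^ (1 - a))).
  - exact: measurable_eball.
  - exact: measurable_frac_kernel.
  - exact: frac_kernel_ge0.
  - exact: exprn_ge0.
  - exact: powR_gt0.
  - exact: hlt1.
  - by move=> k; rewrite divr_ge0 ?powR_ge0// mulr_ge0// ltW.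
  - by move=> k; rewrite mulr_gt0.
  - move=> k; rewrite exprMn powRD; last by rewrite (gt_eqF (u0 k)) implybT.
    rewrite powR_mulrn; last exact: ltW.
    have -> : 2 * u k / (u k ^+ n * u k `^ a) * (2 ^+ n * u k ^+ n) =
        2 ^+ n.+1 * (u k / u k `^ a).
      by rewrite exprS; field; rewrite !gt_eqF ?powR_gt0 ?exprn_gt0.
    rewrite ler_wpM2l ?exprn_ge0//.
    have -> : u k / u k `^ a = u k `^ (1 - a).
      by rewrite powRB ?(gt_eqF (u0 k)) ?implybT// powRr1// ltW.
    rewrite /u -powR_mulrn ?(ltW h0)// -powRrM mulrC powRrM powR_mulrn ?powR_ge0//.
    by rewrite exprSr ler_piMr ?exprn_ge0 ?powR_ge0// ltW.
  - move=> z; rewrite /eball /= subr0 => z1.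
    (* The origin lies in no annulus, but the kernel vanishes there. *)
    have [->|z0] := eqVneq z 0.
      exists 0%N; first by rewrite ?subr0 enorm0 mulr_gt0.
      rewrite /frac_kernel enorm0 (min_idPr _)// mul0r.
      by rewrite divr_ge0 ?powR_ge0// mulr_ge0// ltW.
    have [k /andP[ks sk]] := @dyadic_small (enorm z) ltac:(by rewrite enorm_gt0).
    have suk : enorm z < 2 * u k by rewrite /u exprS mulrA mulfV// mul1r.
    exists k; first by rewrite ?subr0.
    rewrite /frac_kernel ler_pM ?invr_ge0 ?powR_ge0//.
    + by rewrite le_min ler01 enorm_ge0.
    + by rewrite ge_min (ltW suk) orbT.
    + rewrite lef_pV2 ?posrE ?powR_gt0 ?enorm_gt0//.
      by rewrite ge0_ler_powR ?nnegrE ?enorm_ge0 ?(ltW (u0 _)).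
(* Outside the unit ball the numerator is at most 1, and the dyadic annuli give the ratio 2^(-
   a). *)
pose u k : R := 2 ^+ k.
have u0 k : 0 < u k by rewrite exprn_gt0.
apply: (@ball_cover_integral_lty _ _ (fun k => 1 / u k `^ (n%:R + a))
    (fun k => 2 * u k) (2 ^+ n) (2 `^ (- a))).
- exact: mBC.
- exact: measurable_frac_kernel.
- exact: frac_kernel_ge0.
- exact: exprn_ge0.
- exact: powR_gt0.
- rewrite powRN invf_lt1 ?powR_gt0//.
  rewrite -[ltLHS](congr1 (fun f => f a) (powR1 R)).
  by rewrite gt0_ltr_powR ?nnegrE// ltr1n.
- by move=> k; rewrite divr_ge0 ?powR_ge0.
- by move=> k; rewrite mulr_gt0.
- move=> k; rewrite exprMn powRD; last by rewrite (gt_eqF (u0 k)) implybT.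
  rewrite powR_mulrn; last exact: ltW.
  have -> : 1 / (u k ^+ n * u k `^ a) * (2 ^+ n * u k ^+ n) =
      2 ^+ n * (u k `^ a)^-1.
    by field; rewrite !gt_eqF ?powR_gt0 ?exprn_gt0.
  rewrite -powRN (_ : u k `^ (- a) = (2 `^ (- a)) ^+ k)//.
  by rewrite /u -powR_mulrn// -powRrM mulrC powRrM powR_mulrn ?powR_ge0.
- move=> z /=; rewrite /eball /= subr0 => /negP; rewrite -leNgt => z1.
  have [k /andP[ks sk]] := dyadic_large z1.
  exists k; first by rewrite ?subr0 /u -exprS.
  rewrite /frac_kernel ler_pM ?invr_ge0 ?powR_ge0//.
  + by rewrite le_min ler01 enorm_ge0.
  + by rewrite ge_min lexx.
  + rewrite lef_pV2 ?posrE ?powR_gt0 ?(lt_le_trans ltr01 z1)//.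
    by rewrite ge0_ler_powR ?nnegrE ?enorm_ge0 ?(ltW (u0 _)).
Qed.

End singular_kernel.

Section frac_div_integrable.
Context {R : realType} {n : nat} (alpha : R).
Hypothesis halpha : 0 < alpha < 1.
Implicit Types (phi : 'rV[R]_n -> 'rV[R]_n) (x y z : 'rV[R]_n).

(** The integrand in the variable z = y - x: the singularity no longer depends on [x], which suits
    Tonelli. *)
Definition frac_integrand phi x z : R :=
  edot z (phi (z + x) - phi x) / enorm z `^ (n%:R + alpha + 1).

Lemma test_field_continuous phi : test_field setT phi -> continuous phi.
Proof. by move=> [/(_ [::])[]]. Qed.

Lemma measurable_frac_integrand d (T : measurableType d)
    (f g : T -> 'rV[R]_n) phi : continuous phi ->
  measurable_fun setT f -> measurable_fun setT g ->
  measurable_fun setT (fun t => frac_integrand phi (f t) (g t)).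
Proof.
move=> /continuous_measurable_rowf mphi mf mg.
rewrite /frac_integrand; under eq_fun do rewrite -powRN -scaleN1r.
apply: measurable_funM; last first.
  exact: (measurableT_comp (@measurable_powR R _) (measurable_enorm mg)).
apply: measurable_edot => //; apply: measurable_rowD.
  by apply: (measurableT_comp mphi); exact: measurable_rowD.
by apply: measurable_rowZ; exact: (measurableT_comp mphi).
Qed.

Lemma frac_divE phi x : continuous phi ->
  frac_div alpha phi x =
  frac_const n alpha * \int[lebesgue_row n]_z frac_integrand phi x z.
Proof.
move=> cphi.
have mf : measurable_fun setT (frac_integrand phi x).
  by apply: measurable_frac_integrand => //; exact: measurable_cst.
have := @Rintegral_affine R n 1 x _ ltr01 mf.
rewrite expr1n mul1r => <-; rewrite /frac_div; apply: (congr1 ( *%R _)).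
apply: eq_Rintegral => y _.
by rewrite /frac_integrand /affine invr1 scale1r subrK.
Qed.

(** The increment vanishes unless [x] or [z + x] lies in a ball containing the support. Keeping both
    indicators makes the bound integrable in [x] for fixed [z]. *)
Lemma frac_integrand_le phi : test_field setT phi ->
  exists C r, [/\ 0 <= C, 0 < r & forall x z, `|frac_integrand phi x z| <=
    C * frac_kernel alpha z * (\1_(eball 0 r) x + \1_(eball 0 r) (z + x))].
Proof.
move=> tphi; have [L L0 phiL] := test_field_lipschitz tphi.
have [M M0 phiM] := test_field_bounded tphi.
have [r r0 phir] := test_field_support tphi.
exists (Num.max L (n%:R * (2 * M))), r; split => //; first by rewrite le_max L0.
move=> x z; set C := Num.max _ _.
have C0 : 0 <= C by rewrite /C le_max L0.
have K0 := frac_kernel_ge0 alpha z.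
have I0 (A : set 'rV[R]_n) y : 0 <= \1_A y :> R by rewrite indicE.
have S0 := addr_ge0 (I0 (eball 0 r) x) (I0 (eball 0 r) (z + x)).
have CKS0 := mulr_ge0 (mulr_ge0 C0 K0) S0.
have [z0|z0] := eqVneq z 0.
  by rewrite /frac_integrand {1}z0 edot0l mul0r normr0.
have e0 := enorm_gt0 z0.
have [xr|xr] := pselect (eball 0 r x \/ eball 0 r (z + x)); last first.
  have [xr1 xr2] : ~ eball 0 r x /\ ~ eball 0 r (z + x).
    by split=> h; apply: xr; [left|right].
  by rewrite /frac_integrand !phir// subrr edotC edot0l mul0r normr0.
apply: (@le_trans _ _ (C * frac_kernel alpha z)); last first.
  apply: ler_peMr.
    by rewrite mulr_ge0 ?frac_kernel_ge0.
  case: xr => h; first by rewrite [X in X + _]indicE mem_set// lerDl; exact: I0.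
  by rewrite [X in _ + X]indicE mem_set// lerDr; exact: I0.
rewrite /frac_integrand normrM normfV (ger0_norm (powR_ge0 _ _)).
rewrite powRD; last by rewrite (gt_eqF e0) implybT.
rewrite powRr1 ?(ltW e0)// /frac_kernel.
set P := enorm z `^ _; have P0 : 0 < P by rewrite powR_gt0.
rewrite ler_pdivrMr; last by rewrite mulr_gt0.
have -> : C * (Num.min 1 (enorm z) / P) * (P * enorm z) =
    enorm z * (C * Num.min 1 (enorm z)).
  by field; rewrite gt_eqF.
apply: (le_trans (normr_edot_le _ _)); rewrite ler_wpM2l ?(ltW e0)//.
have d1 : enorm (phi (z + x) - phi x) <= C * enorm z.
  by apply: (le_trans (phiL _ _)); rewrite ler_wpM2r ?(ltW e0)// /C le_max lexx.
have d2 : enorm (phi (z + x) - phi x) <= C * 1.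
  rewrite mulr1 /C le_max; apply/orP; right.
  apply: (le_trans (enorm_le_norm _)); rewrite ler_wpM2l//.
  apply: (le_trans (ler_normB _ _)).
  by rewrite mulr_natl mulr2n lerD.
by rewrite /Num.min; case: ifP.
Qed.

(** Integration in [x] comes first: it turns the two indicators into twice the volume of a ball, by
    translation invariance, and leaves the integrable kernel in [z]. *)
Lemma integrable_frac_integrand phi : test_field setT phi ->
  (lebesgue_row n \x lebesgue_row n)%E.-integrable setT
    (fun p => (frac_integrand phi p.1 p.2)%:E).
Proof.
move=> tphi; have cphi := test_field_continuous tphi.
have mG : measurable_fun setT (fun p : 'rV[R]_n * 'rV[R]_n => (frac_integrand phi p.1 p.2)%:E).
  by apply/measurable_EFinP; apply: measurable_frac_integrand.
apply/(integrable21ltyP _ _ mG) => /=.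
have [C [r [C0 r0 GC]]] := frac_integrand_le tphi.
have mB : measurable (eball (0 : 'rV[R]_n) r) by exact: measurable_eball.
set v := lebesgue_row n (eball (0 : 'rV[R]_n) r).
have v0 : (0 <= v)%E by exact: measure_ge0.
have vv0 : 0 <= C * fine (v + v)%E by rewrite mulr_ge0// fine_ge0// adde_ge0.
have vfin : v \is a fin_num.
  rewrite /v ge0_fin_numE//; apply: lebesgue_row_bounded => //.
  exact: bounded_eball.
have mI : measurable_fun setT (fun x : 'rV[R]_n => (\1_(eball 0 r) x)%:E : \bar R).
  by apply/measurable_EFinP; exact: measurable_indic.
have I0 (y : 'rV[R]_n) : (0 <= (\1_(eball 0 r) y)%:E :> \bar R)%E.
  by rewrite lee_fin indicE.
have inner z : (\int[lebesgue_row n]_x `|(frac_integrand phi x z)%:E| <=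
    (C * fine (v + v) * frac_kernel alpha z)%:E)%E.
  have K0 : 0 <= C * frac_kernel alpha z by rewrite mulr_ge0 ?frac_kernel_ge0.
  have mIz : measurable_fun setT (fun x : 'rV[R]_n => (\1_(eball 0 r) (z + x))%:E : \bar R).
    apply: (measurableT_comp mI); apply: measurable_rowD => //.
  apply: (@le_trans _ _ (\int[lebesgue_row n]_x ((C * frac_kernel alpha z)%:E *
     ((\1_(eball 0 r) x)%:E + (\1_(eball 0 r) (z + x))%:E)))%E).
    apply: ge0_le_integral => //.
    - apply: measurableT_comp => //; apply/measurable_EFinP.
      by apply: measurable_frac_integrand => //.
    - by apply: measurable_funeM; exact: emeasurable_funD.
    - by move=> x _ /=; rewrite -EFinD -EFinM lee_fin GC.
  rewrite ge0_integralZl//; last 2 first.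
  - exact: emeasurable_funD.
  - by move=> x _; rewrite -EFinD lee_fin addr_ge0.
  rewrite ge0_integralD//.
  have E1 : (\int[lebesgue_row n]_x (\1_(eball 0 r) x)%:E = v)%E.
    by rewrite integral_indic// setIT.
  have E2 : (\int[lebesgue_row n]_x (\1_(eball 0 r) (z + x))%:E = v)%E.
    have := @ge0_integral_affine R n 1 (- z) _ ltr01 mI I0.
    rewrite expr1n mul1e E1 => <-.
    by apply: eq_integral => x _; rewrite /affine invr1 scale1r opprK (addrC x).
  rewrite E1 E2 -[X in (_ * X)%E]fineK ?fin_numD ?vfin// -EFinM lee_fin.
  by rewrite mulrAC.
apply: (@le_lt_trans _ _ (\int[lebesgue_row n]_z ((C * fine (v + v))%:E * (frac_kernel alpha z)%:E))%E).
  apply: ge0_le_integral => //.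
  - by move=> z _; apply: integral_ge0 => x _.
  - apply: (measurable_fun_fubini_tonelli_G (fun p => `|(frac_integrand phi p.1 p.2)%:E|%E)) => //.
    exact: measurableT_comp.
  - by apply: measurable_funeM; apply/measurable_EFinP; exact: measurable_frac_kernel.
  - by move=> z _; exact: inner.
rewrite ge0_integralZl ?lee_fin//; last 2 first.
- by apply/measurable_EFinP; exact: measurable_frac_kernel.
- by move=> z _; rewrite lee_fin frac_kernel_ge0.
by apply: lte_mul_pinfty => //; exact: frac_kernel_integral_lty.
Qed.

Lemma integrable_frac_div phi : test_field setT phi ->
  (lebesgue_row n).-integrable setT (EFin \o frac_div alpha phi).
Proof.
move=> tphi; have cphi := test_field_continuous tphi.
have iG := integrable_frac_integrand tphi.
have iF := integrable_fubini_F iG.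
have -> : EFin \o frac_div alpha phi = (fun x => (frac_const n alpha)%:E *
    (EFin \o (fine \o fubini_F (lebesgue_row n) (fun p => (frac_integrand phi p.1 p.2)%:E))) x)%E.
  by apply/funext => x /=; rewrite frac_divE// EFinM.
apply: integrableZl => //.
apply: (le_integrable _ _ _ iF) => //.
  apply/measurable_EFinP; apply: measurableT_comp; last exact: measurable_int iF.
  exact: fine_measurable.
(* Where the inner integral is infinite, [fine] replaces it by 0, which keeps the domination. *)
move=> x _ /=; set t := fubini_F _ _ _.
by case: t => [t| |] //=; rewrite normr0 leey.
Qed.

End frac_div_integrable.

(** * Lebesgue measurable sets *)

Section nonmeasurable_integrands.
Context d (T : measurableType d) (R : realType) (mu : {measure set T -> \bar R}).
Local Open Scope ereal_scope.

(* The integral of a nonnegative function is a supremum over simple functions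
   below it, hence monotone without any measurability assumption. *)
Lemma ge0_le_integralT (f g : T -> \bar R) : (forall x, 0 <= f x) ->
  (forall x, f x <= g x) -> \int[mu]_x f x <= \int[mu]_x g x.
Proof.
move=> f0 fg; rewrite !ge0_integralTE//; last first.
  by move=> x; exact: le_trans (f0 x) (fg x).
apply: ereal_sup_le => _ [h hf <-]; exists h => // x.
exact: le_trans (hf x) (fg x).
Qed.

(** Only the smaller function is measurable. This suits [g] built from indicators of Lebesgue
    measurable sets, which may fail to be Borel. *)
Lemma ge0_le_integral_negl (D N : set T) (f g : T -> \bar R) : measurable D ->
  measurable N -> mu N = 0 -> measurable_fun setT f ->
  (forall x, 0 <= f x) -> (forall x, 0 <= g x) ->
  (forall x, ~ N x -> f x <= g x) ->
  \int[mu]_(x in D) f x <= \int[mu]_(x in D) g x.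
Proof.
move=> mD mN N0 mf f0 g0 fg.
rewrite (ge0_negligible_integral mN)//; last exact: measurable_funTS.
rewrite integral_mkcond [leRHS]integral_mkcond; apply: ge0_le_integralT => x.
  by apply: erestrict_ge0 => y _; exact: f0.
rewrite /patch; case: ifPn => [/set_mem[Dx Nx]|_]; first by rewrite mem_set// fg.
by case: ifP.
Qed.

(** Monotonicity without measurability encloses the integral over [E] between those over [A] and
    [B], which coincide since [B \ A] is null. *)
Lemma ge0_integral_sandwich (A E B : set T) (f : T -> \bar R) :
  measurable A -> measurable B -> A `<=` E -> E `<=` B -> mu (B `\` A) = 0 ->
  measurable_fun setT f -> (forall x, 0 <= f x) ->
  \int[mu]_(x in E) f x = \int[mu]_(x in A) f x.
Proof.
move=> mA mB AE EB BA mf f0.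
have mono (C C' : set T) : C `<=` C' ->
    \int[mu]_(x in C) f x <= \int[mu]_(x in C') f x.
  move=> CC; rewrite integral_mkcond [leRHS]integral_mkcond.
  apply: ge0_le_integralT => x; first by apply: erestrict_ge0.
  rewrite /patch; case: ifPn => [/set_mem/CC Cx|_]; first by rewrite mem_set.
  by case: ifP.
apply/eqP; rewrite eq_le; apply/andP; split; last exact: mono.
apply: (le_trans (mono _ _ EB)).
rewrite (ge0_negligible_integral _ _ _ _ BA)//; last 2 first.
- exact: measurableD.
- exact: measurable_funTS.
by rewrite setDD; apply: mono => x [].
Qed.

Lemma Rintegral_sandwich (A E B : set T) (f : T -> R) :
  measurable A -> measurable B -> A `<=` E -> E `<=` B -> mu (B `\` A) = 0 ->
  measurable_fun setT f ->
  (\int[mu]_(x in E) f x = \int[mu]_(x in A) f x)%R.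
Proof.
move=> mA mB AE EB BA /measurable_EFinP mf.
rewrite /Rintegral integralE [in RHS]integralE.
rewrite (ge0_integral_sandwich mA mB AE EB BA (measurable_funepos mf))//.
by rewrite (ge0_integral_sandwich mA mB AE EB BA (measurable_funeneg mf)).
Qed.

End nonmeasurable_integrands.

Section borel_core.
Context {R : realType} {n : nat}.
Implicit Types (A E F : set 'rV[R]_n) (x y : 'rV[R]_n).

(** A Borel subset of full measure, on which all integrals over [E] are computed. *)
Definition borel_core E A := measurable A /\ exists B,
  [/\ measurable B, A `<=` E, E `<=` B & lebesgue_row n (B `\` A) = 0%E].

Lemma lebesgue_measurable_core E : lebesgue_measurable E ->
  exists A, borel_core E A.
Proof. by move=> [A [B [mA mB AE EB BA]]]; exists A; split => //; exists B. Qed.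

Lemma Rintegral_core E A (f : 'rV[R]_n -> R) : borel_core E A ->
  measurable_fun setT f ->
  \int[lebesgue_row n]_(x in E) f x = \int[lebesgue_row n]_(x in A) f x.
Proof. by move=> [mA [B [mB AE EB BA]]]; exact: Rintegral_sandwich BA. Qed.

(** As a preimage under an affine map of scale 1 / r, the blow-up inherits measurability and the
    scaling of Lebesgue measure. *)
Lemma blow_upE E x r : r != 0 ->
  blow_up E x r = affine r^-1 (- (r^-1 *: x)) @^-1` E.
Proof.
move=> r0; apply/seteqP; split=> y; rewrite /blow_up /affine /= invrK opprK scalerDr scalerA mulfV// scale1r.
  by move=> [z Ez <-]; rewrite scalerA mulfV// scale1r subrK.
move=> Ey; exists (r *: y + x) => //.
by rewrite addrK scalerA mulVf// scale1r.
Qed.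

Lemma borel_core_blow_up E A x r : 0 < r -> borel_core E A ->
  borel_core (blow_up E x r) (blow_up A x r).
Proof.
move=> r0 [mA [B [mB AE EB BA]]].
have ri0 : 0 < r^-1 by rewrite invr_gt0.
have mpre C : measurable C -> measurable (affine r^-1 (- (r^-1 *: x)) @^-1` C).
  by move=> mC; rewrite -[X in measurable X]setTI; exact: measurable_affine.
rewrite /borel_core !blow_upE ?gt_eqF//; split; first exact: mpre.
exists (blow_up B x r); rewrite blow_upE ?gt_eqF//; split; first exact: mpre.
- exact: preimage_subset.
- exact: preimage_subset.
rewrite [LHS](_ : _ = lebesgue_row n (affine r^-1 (- (r^-1 *: x)) @^-1` (B `\` A)))//.
rewrite (lebesgue_row_affine _ ri0); last exact: measurableD.
by rewrite BA mule0.
Qed.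

End borel_core.

(** * Rescaled test fields and scaling of the fractional divergence *)

Section affine_test_fields.
Context {R : realType} {n : nat}.
Implicit Types (f phi : 'rV[R]_n -> 'rV[R]_n) (x y z : 'rV[R]_n).

Lemma is_derive_affine f r x y v df : 0 < r ->
  is_derive (affine r x y) v f df ->
  is_derive y v (fun y => f (affine r x y)) (r^-1 *: df).
Proof.
move=> r0 [d1 d2].
(* The difference quotient of the rescaled field at step [h] is 1 / r times that of [f] at step h /
   r, and h / r stays nonzero. *)
have cvg0 : (fun h : R => r^-1 * h) @ 0^' --> 0^'.
  move=> A /=; rewrite /dnbhs /within /= => A0.
  have : (fun h : R => r^-1 * h) @ (0 : R) --> (0 : R).
    rewrite -[X in _ --> X](mulr0 r^-1).
    exact: (cvgM (cvg_cst _) cvg_id).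
  move=> /(_ _ A0) A1; rewrite /fmap /=.
  apply: (@filterS _ (nbhs (0 : R)) _ _ _ _ A1) => h /= hA h0.
  by apply: hA; rewrite mulf_neq0// invr_eq0 gt_eqF.
have h : (fun h : R => h^-1 *: ((f \o shift (affine r x y)) (h *: v) - f (affine r x y))) @ 0^' --> df.
  by rewrite -d2; exact: d1.
have {}h := cvg_comp _ _ cvg0 h.
have {}h : (fun h : R => h^-1 *: (((fun y => f (affine r x y)) \o shift y) (h *: v) -
    f (affine r x y))) @ 0^' --> r^-1 *: df.
  rewrite [X in X @ _](_ : _ = fun h : R => r^-1 *: ((r^-1 * h)^-1 *:
    ((f \o shift (affine r x y)) ((r^-1 * h) *: v) - f (affine r x y)))).
    by apply: cvgZl_tmp; exact: h.
  apply/funext => s /=; rewrite scalerA invfM invrK mulrA mulVf ?gt_eqF// mul1r.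
  congr (_ *: (f _ - _)); rewrite /affine.
  by rewrite -scalerA -scalerDr addrA.
by apply: DeriveDef; [apply/cvg_ex; eexists; exact: h|apply: cvg_lim => //; exact: norm_hausdorff].
Qed.

Lemma affine_continuous r x : continuous (@affine R n r x).
Proof.
move=> y; apply: (@cvgZl_tmp _ _ _ (nbhs y)).
by apply: cvgB; [exact: cvg_id|exact: cvg_cst].
Qed.

(** Every partial derivative brings out a factor 1 / r, so iterated derivatives are again rescaled
    ones. *)
Lemma smooth_affine phi r x : 0 < r -> smooth phi ->
  smooth (fun y => phi (affine r x y)).
Proof.
move=> r0 sphi.
have foldE s : foldr partial_derive (fun y => phi (affine r x y)) s =
    (fun y => r^-1 ^+ size s *: foldr partial_derive phi s (affine r x y)).
  elim: s => [|i s IH]; first by apply/funext => y /=; rewrite expr0 scale1r.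
  rewrite /= IH; apply/funext => y; rewrite /partial_derive.
  have [_ /(_ i (affine r x y)) ds] := sphi s.
  have dsa := is_derive_affine r0 (derivableP ds).
  have [_ ->] := @is_deriveZ _ _ _ _ (r^-1 ^+ size s) _ _ _ dsa.
  by rewrite scalerA exprSr.
move=> s; rewrite foldE; have [cs ds] := sphi s; split.
  move=> y; apply: (@cvgZl_tmp _ _ _ (nbhs y)).
  exact: (cvg_comp _ _ (@affine_continuous r x y) (cs _)).
move=> i y.
have dsa := is_derive_affine r0 (derivableP (ds i (affine r x y))).
by have [] := @is_deriveZ _ _ _ _ (r^-1 ^+ size s) _ _ _ dsa.
Qed.

Lemma test_field_affine phi r x U V : 0 < r -> bounded_set V ->
  affine r x @^-1` U `<=` V -> test_field U phi ->
  test_field V (fun y => phi (affine r x y)).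
Proof.
move=> r0 bV UV [sphi cK KU].
have sub : closure [set y | phi (affine r x y) != 0] `<=`
    affine r x @^-1` closure [set y | phi y != 0].
  have cl : closed (affine r x @^-1` closure [set y | phi y != 0]).
    apply: preimage_closed; last exact: closed_closure.
    by move=> y _; exact: affine_continuous.
  rewrite [X in _ `<=` X](closure_id _).1//; apply: closureS => y /= py.
  exact: subset_closure.
have subV : closure [set y | phi (affine r x y) != 0] `<=` V.
  by move=> y /sub /KU /UV.
split; [exact: smooth_affine| |exact: subV].
apply: bounded_closed_compact; [exact: sub_bounded bV|exact: closed_closure].
Qed.

End affine_test_fields.

Lemma Rintegral_pZl d (T : measurableType d) (R : realType)
    (mu : {measure set T -> \bar R}) (c : R) (f : T -> R) :
  0 < c -> measurable_fun setT f ->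
  \int[mu]_x (c * f x) = c * \int[mu]_x f x.
Proof.
move=> c0 /measurable_EFinP mf; rewrite /Rintegral.
rewrite (eq_integral (fun x => c%:E * (f x)%:E)%E)//.
rewrite integralE (ge0_funeposM _ (ltW c0)) (ge0_funenegM _ (ltW c0)).
have mfp := measurable_funepos mf; have mfn := measurable_funeneg mf.
rewrite !ge0_integralZl ?lee_fin ?(ltW c0)//.
pose a := (\int[mu]_y (fun y => (f y)%:E)^\+ y)%E.
pose b := (\int[mu]_y (fun y => (f y)%:E)^\- y)%E.
rewrite [X in _ = c * fine X](_ : _ = a - b)%E; last exact: integralE.
rewrite -[X in (_ * X - _)%E]/a -[X in (_ - _ * X)%E]/b.
have : (0 <= a)%E by apply: integral_ge0.
have : (0 <= b)%E by apply: integral_ge0.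
case: (a) => [a'| |]; case: (b) => [b'| |] //= _ _.
all: rewrite ?gt0_muley ?lte_fin//= ?mulrBr ?mulr0//.
Qed.

Lemma Rintegral_affineZ (R : realType) n (r c : R) (x : 'rV[R]_n)
    (f : 'rV[R]_n -> R) : 0 < r -> 0 < c -> measurable_fun setT f ->
  \int[lebesgue_row n]_y (c * f (affine r x y)) =
  r ^+ n * c * \int[lebesgue_row n]_y f y.
Proof.
move=> r0 c0 mf; have mfa : measurable_fun setT (fun y => f (affine r x y)).
  exact: (measurableT_comp mf (measurable_affine r x)).
by rewrite (Rintegral_pZl _ c0 mfa) (Rintegral_affine x r0 mf) mulrCA mulrA.
Qed.

Section frac_div_scaling.
Context {R : realType} {n : nat} (alpha : R).
Hypothesis halpha : 0 < alpha < 1.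
Implicit Types (phi : 'rV[R]_n -> 'rV[R]_n) (x y z : 'rV[R]_n).

(** The scalar product contributes [r] and the denominator r^(- (n + alpha + 1)). *)
Lemma frac_integrand_affine phi r x y z : 0 < r ->
  frac_integrand alpha (fun y => phi (affine r x y)) y z =
  r `^ (- (n%:R + alpha)) * frac_integrand alpha phi (affine r x y) (affine r 0 z).
Proof.
move=> r0; rewrite /frac_integrand.
have -> : affine r x (z + y) = affine r 0 z + affine r x y.
  by rewrite /affine subr0 -scalerDr addrA.
set v := phi _ - phi _.
have zE : z = r *: affine r 0 z.
  by rewrite /affine subr0 scalerA mulfV ?gt_eqF// scale1r.
have -> : edot z v = r * edot (affine r 0 z) v by rewrite {1}zE edotZl.
have -> : enorm z = r * enorm (affine r 0 z).
  by rewrite {1}zE enormZ ger0_norm ?(ltW r0).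
rewrite powRM ?(ltW r0) ?enorm_ge0//.
have -> : r `^ (n%:R + alpha + 1) = r `^ (n%:R + alpha) * r.
  by rewrite powRD ?powRr1 ?(ltW r0)// (gt_eqF r0) implybT.
rewrite powRN.
set P := r `^ _; set Q := enorm _ `^ _.
have P0 : P != 0 by rewrite gt_eqF// powR_gt0.
by rewrite invfM; move: (Q^-1) => q; field; rewrite P0 gt_eqF.
Qed.

Lemma frac_div_affine phi r x y : 0 < r -> continuous phi ->
  frac_div alpha (fun y => phi (affine r x y)) y =
  r `^ (- alpha) * frac_div alpha phi (affine r x y).
Proof.
move=> r0 cphi.
have cphi' : continuous (fun y => phi (affine r x y)).
  by move=> z; exact: (cvg_comp _ _ (@affine_continuous R n r x z) (cphi _)).
rewrite !frac_divE// mulrCA; apply: (congr1 ( *%R _)).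
have mf : measurable_fun setT (frac_integrand alpha phi (affine r x y)).
  by apply: measurable_frac_integrand => //; exact: measurable_cst.
have c0 : 0 < r `^ (- (n%:R + alpha)) by rewrite powR_gt0.
under eq_Rintegral do rewrite frac_integrand_affine//.
have := @Rintegral_affine R n r 0
  (fun z => r `^ (- (n%:R + alpha)) * frac_integrand alpha phi (affine r x y) z) r0.
move=> ->; last exact: measurable_funM.
rewrite Rintegral_pZl// mulrA; congr (_ * _).
rewrite -powR_mulrn ?(ltW r0)// -powRD; last by rewrite (gt_eqF r0) implybT.
by congr (_ `^ _); ring.
Qed.

Lemma blow_up_affine (E : set 'rV[R]_n) r x y : 0 < r ->
  blow_up E x r (affine r x y) <-> E y.
Proof.
move=> r0; split=> [[z Ez]|Ey]; last by exists y.
move=> /(congr1 (fun v => r *: v)).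
rewrite /affine !scalerA mulfV ?gt_eqF// !scale1r => /(congr1 (+%R^~ x)).
by rewrite !subrK => <-.
Qed.

(** The Jacobian r^n meets the factor r^(- alpha) of the divergence; this is the source of the
    exponent n - alpha in the density bound. *)
Lemma Rintegral_frac_div_affine (E : set 'rV[R]_n) phi r x : 0 < r ->
  lebesgue_measurable E -> test_field setT phi ->
  \int[lebesgue_row n]_(y in E) frac_div alpha (fun y => phi (affine r x y)) y =
  r `^ (n%:R - alpha) *
    \int[lebesgue_row n]_(y in blow_up E x r) frac_div alpha phi y.
Proof.
move=> r0 /lebesgue_measurable_core[A EA] tphi.
have cphi := test_field_continuous tphi.
have iphi := integrable_frac_div halpha tphi.
have mphi : measurable_fun setT (frac_div alpha phi).
  by apply/measurable_EFinP; exact: measurable_int iphi.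
have bA := borel_core_blow_up x r0 EA.
have fE : frac_div alpha (fun y => phi (affine r x y)) =
    (fun y => r `^ (- alpha) * frac_div alpha phi (affine r x y)).
  by apply/funext => y; rewrite frac_div_affine.
have mfa : measurable_fun setT (fun y => frac_div alpha phi (affine r x y)).
  exact: (measurableT_comp mphi (measurable_affine r x)).
rewrite fE (Rintegral_core EA); last exact: measurable_funM.
rewrite (Rintegral_core bA)//.
have [mA _] := EA; have [mbA _] := bA.
rewrite Rintegral_mkcond [in RHS]Rintegral_mkcond.
have c0 : 0 < r `^ (- alpha) by rewrite powR_gt0.
have mg : measurable_fun setT (frac_div alpha phi \_ (blow_up A x r)).
  exact: ((measurable_restrictT (frac_div alpha phi) mbA).1 (measurable_funTS mphi)).
have -> : r `^ (n%:R - alpha) = r ^+ n * r `^ (- alpha).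
  by rewrite powRD ?powR_mulrn ?(ltW r0)// (gt_eqF r0) implybT.
rewrite -(Rintegral_affineZ x r0 c0 mg).
apply: eq_Rintegral => y _; rewrite /patch.
have [Ay|Ay] := pselect (A y).
  by rewrite !mem_set//; exact/blow_up_affine.
have bAy : ~ blow_up A x r (affine r x y).
  by move=> h; apply: Ay; move: h; apply: (blow_up_affine _ _ _ r0).1.
by rewrite !memNset ?mulr0.
Qed.

Lemma Lnorm_affine phi r x : 0 < r ->
  (Lnorm (lebesgue_row n) +oo (fun y => (enorm (phi y))%:E) <= 1)%E ->
  (Lnorm (lebesgue_row n) +oo (fun y => (enorm (phi (affine r x y)))%:E) <= 1)%E.
Proof.
move=> r0; rewrite unlock; case: ifP => // _ /ess_supP[N [mN N0 NP]].
apply/ess_supP; exists (affine r x @^-1` N); split.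
- by rewrite -[X in measurable X]setTI; exact: measurable_affine.
- by apply: etrans (lebesgue_row_affine x r0 mN) _; rewrite N0 mule0.
- by move=> y /= hy; apply: NP.
Qed.

End frac_div_scaling.

(** * Limits of integrals under local convergence of sets *)

Section L1loc_convergence.
Context {R : realType} {n : nat}.
Implicit Types (g : 'rV[R]_n -> R).

Definition norm_ball (M : R) : set 'rV[R]_n := [set x | `|x| <= M].

Lemma closed_norm_ball M : closed (norm_ball M).
Proof.
apply: (@preimage_closed _ _ (fun x : 'rV[R]_n => `|x|) [set t | t <= M]).
  by move=> x _; exact: norm_continuous.
exact: closed_le.
Qed.

Lemma compact_norm_ball M : compact (norm_ball M).
Proof.
apply: bounded_closed_compact; last exact: closed_norm_ball.
by apply/bounded_setP; exists M.
Qed.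

Lemma measurable_norm_ball M : measurable (norm_ball M).
Proof.
rewrite -[X in measurable X]setCK; apply: measurableC.
by apply: measurable_open_row; exact: (closed_openC (@closed_norm_ball M)).
Qed.

Lemma measurable_core g M : measurable_fun setT g ->
  measurable (norm_ball M `&` [set y | `|g y| <= M]).
Proof.
move=> mg; apply: measurableI; first exact: measurable_norm_ball.
have mn : measurable_fun setT (fun y => `|g y|) by exact: measurableT_comp.
rewrite (_ : [set y | _] = (fun y => `|g y|) @^-1` `]-oo, M]%classic).
  by rewrite -[X in measurable X]setTI; exact: mn.
by apply/seteqP; split=> y; rewrite /= in_itv/=.
Qed.

(** Every point eventually enters the truncated region, so dominated convergence applies. Both |y|
    and |g(y)| are truncated: [g] is only integrable, and the truncation must give a uniform
    bound. *)
Lemma integral_tail_cvg0 g : (lebesgue_row n).-integrable setT (EFin \o g) ->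
  (fun M : nat => \int[lebesgue_row n]_y
    (`|g y| * \1_(~` (norm_ball M%:R `&` [set y | (`|g y| <= M%:R)%R])) y)%:E)%E
   @ \oo --> 0%E.
Proof.
move=> ig.
have mg : measurable_fun setT g by apply/measurable_EFinP; exact: measurable_int ig.
pose Z (M : nat) := ~` (norm_ball M%:R `&` [set y | `|g y| <= M%:R]).
have mZ M : measurable (Z M).
  by apply: measurableC; exact: measurable_core.
have mh M : measurable_fun setT (fun y => (`|g y| * \1_(Z M) y)%:E).
  apply/measurable_EFinP; apply: measurable_funM; first exact: measurableT_comp.
  exact: measurable_indic.
have [] := @dominated_convergence _ _ _ (lebesgue_row n) setT measurableT
  (fun M y => (`|g y| * \1_(Z M) y)%:E) (cst 0%E) (fun y => `|(g y)%:E|%E).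
- exact: mh.
- exact: measurable_cst.
- apply: aeW => y _; apply: cvg_near_cst.
  exists (maxn (Num.truncn `|y|).+1 (Num.truncn `|g y|).+1) => // M /= hM.
  have Xy : (norm_ball M%:R `&` [set y | `|g y| <= M%:R]) y.
    split; rewrite /norm_ball /= (le_trans (ltW (truncnS_gt _)))// ler_nat.
      by rewrite (leq_trans _ hM)// leq_maxl.
    by rewrite (leq_trans _ hM)// leq_maxr.
  by rewrite indicE memNset ?mulr0// => /(_ Xy).
- exact: integrable_abse.
- apply: aeW => y M _; rewrite lee_fin normrM normr_id ler_piMr//.
  by rewrite indicE; case: (_ \in _); rewrite ?normr1 ?normr0.
move=> _ _; rewrite (_ : \int[_]_(x in _) _ = 0)%E; first by [].
by rewrite integral0.
Qed.

(** On the region where |y| and |g| are at most [M], the difference is bounded by [M] times the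
    local distance of the sets; the rest is a tail independent of [k]. First [M] is fixed by the
    tail, then [k] grows. *)
Lemma cvg_Rintegral_L1loc (E : nat -> set 'rV[R]_n) F g :
  (forall k, lebesgue_measurable (E k)) -> lebesgue_measurable F ->
  cvg_L1loc E F -> (lebesgue_row n).-integrable setT (EFin \o g) ->
  (fun k => \int[lebesgue_row n]_(y in E k) g y) @ \oo -->
  \int[lebesgue_row n]_(y in F) g y.
Proof.
move=> mE mF EF ig.
have mg : measurable_fun setT g by apply/measurable_EFinP; exact: measurable_int ig.
have [C [mC [C' [mC' CF FC' C'C]]]] := lebesgue_measurable_core mF.
pose A k := sval (cid (lebesgue_measurable_core (mE k))).
have AE k : borel_core (E k) (A k) by rewrite /A; case: cid.
have mA k : measurable (A k) by have [] := AE k.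
pose Delta k y : R := `|\1_(A k) y - \1_C y|.
have mDelta k : measurable_fun setT (Delta k).
  apply: measurableT_comp => //; apply: measurable_funB; exact: measurable_indic.
have Delta01 k y : 0 <= Delta k y <= 1.
  rewrite /Delta !indicE normr_ge0/=.
  by case: (_ \in A k); case: (_ \in C); rewrite ?subrr ?subr0 ?sub0r ?normrN ?normr0 ?normr1.
(* The hypothesis concerns the sets themselves, the measurable [Delta] their Borel cores; the
   indicators differ only on the null set [(B \ A k)] united with [(C' \ C)]. *)
have DeltaE k M : (\int[lebesgue_row n]_(y in norm_ball M) (Delta k y)%:E <=
    \int[lebesgue_row n]_(y in norm_ball M) (`|\1_(E k) y - \1_F y|)%:E)%E.
  have [_ [B [mB AEk EkB BA]]] := AE k.
  apply: (@ge0_le_integral_negl _ _ _ _ _ ((B `\` A k) `|` (C' `\` C))).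
  - exact: measurable_norm_ball.
  - by apply: measurableU; exact: measurableD.
  - by rewrite null_set_setU//; exact: measurableD.
  - exact/measurable_EFinP.
  - by move=> y; rewrite lee_fin; have /andP[] := Delta01 k y.
  - by move=> y; rewrite lee_fin.
  - move=> y hy; rewrite lee_fin /Delta.
    have -> : \1_(A k) y = \1_(E k) y :> R.
      rewrite !indicE; congr (_ %:R); congr (nat_of_bool _).
      apply/idP/idP => /set_mem h; apply/mem_set; first exact: AEk.
      by apply: contrapT => nA; apply: hy; left; split => //; exact: EkB.
    have -> // : \1_C y = \1_F y :> R.
    rewrite !indicE; congr (_ %:R); congr (nat_of_bool _).
    apply/idP/idP => /set_mem h; apply/mem_set; first exact: CF.
    by apply: contrapT => nA; apply: hy; right; split => //; exact: FC'.
have DeltaK M : (fun k => \int[lebesgue_row n]_(y in norm_ball M) (Delta k y)%:E)%E @ \oo --> 0%E.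
  apply: (squeeze_cvge _ (cvg_cst 0%E) (EF _ (@compact_norm_ball M))).
  apply: nearW => k; rewrite DeltaE andbT; apply: integral_ge0 => y _.
  by rewrite lee_fin; have /andP[] := Delta01 k y.
have restr (S : set 'rV[R]_n) : g \_ S = (fun y => g y * \1_S y).
  by apply/funext => y; rewrite /patch indicE; case: ifPn => _; rewrite ?mulr1 ?mulr0.
have iS (S : set 'rV[R]_n) : measurable S ->
    (lebesgue_row n).-integrable setT (EFin \o (fun y => g y * \1_S y)).
  move=> mS; apply: (le_integrable _ _ _ ig) => //.
    by apply/measurable_EFinP; apply: measurable_funM => //; exact: measurable_indic.
  move=> y _ /=; rewrite lee_fin normrM ler_piMr// indicE.
  by case: (_ \in _); rewrite ?normr1 ?normr0.
have IE k : \int[lebesgue_row n]_(y in E k) g y = \int[lebesgue_row n]_y (g y * \1_(A k) y).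
  by rewrite (Rintegral_core (AE k) mg) Rintegral_mkcond restr.
have IF : \int[lebesgue_row n]_(y in F) g y = \int[lebesgue_row n]_y (g y * \1_C y).
  have FC : borel_core F C by split => //; exists C'.
  by rewrite (Rintegral_core FC mg) Rintegral_mkcond restr.
pose tail (M : nat) := (\int[lebesgue_row n]_y
    (`|g y| * \1_(~` (norm_ball M%:R `&` [set y | (`|g y| <= M%:R)%R])) y)%:E)%E.
have key k (M : nat) : (`|\int[lebesgue_row n]_(y in E k) g y -
     \int[lebesgue_row n]_(y in F) g y|%:E <=
   M%:R%:E * (\int[lebesgue_row n]_(y in norm_ball M%:R) (Delta k y)%:E) + tail M)%E.
  pose Z := ~` (norm_ball M%:R `&` [set y | `|g y| <= M%:R]).
  have mZ : measurable Z.
    by apply: measurableC; exact: measurable_core.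
  rewrite IE IF -RintegralB//; [|exact: iS|exact: iS].
  have iD : (lebesgue_row n).-integrable setT (EFin \o (fun y => g y * \1_(A k) y - g y * \1_C y)).
    by have := integrableB measurableT (iS _ (mA k)) (iS _ mC).
  rewrite (EFin_normr_Rintegral _ iD)//.
  apply: (le_trans (le_abse_integral _ _ _)) => //; first exact: measurable_int iD.
  have mND : measurable_fun setT (fun y : 'rV[R]_n => (\1_(norm_ball M%:R) y * Delta k y)%:E).
    apply/measurable_EFinP; apply: measurable_funM => //.
    by apply: measurable_indic; exact: measurable_norm_ball.
  have mgZ : measurable_fun setT (fun y : 'rV[R]_n => (`|g y| * \1_Z y)%:E).
    apply/measurable_EFinP; apply: measurable_funM; first exact: measurableT_comp.
    exact: measurable_indic.
  have ND0 y : (0 <= (\1_(norm_ball M%:R) y * Delta k y)%:E :> \bar R)%E.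
    have /andP[d0 _] := Delta01 k y; rewrite lee_fin mulr_ge0// indicE//.
  have gZ0 y : (0 <= (`|g y| * \1_Z y)%:E :> \bar R)%E.
    by rewrite lee_fin mulr_ge0// indicE.
  have -> : (\int[lebesgue_row n]_(y in norm_ball M%:R) (Delta k y)%:E =
     \int[lebesgue_row n]_y (\1_(norm_ball M%:R) y * Delta k y)%:E)%E.
    rewrite integral_mkcond; apply: eq_integral => y _.
    by rewrite /patch indicE; case: ifPn => _; rewrite ?mul1r ?mul0r.
  rewrite -ge0_integralZl ?lee_fin// -ge0_integralD//; last 2 first.
  - by move=> y _; rewrite mule_ge0// lee_fin.
  - exact: measurable_funeM.
  apply: ge0_le_integral => //.
  - by apply: measurableT_comp => //; exact: measurable_int iD.
  - by apply: emeasurable_funD => //; exact: measurable_funeM.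
  move=> y _; rewrite -EFinM -EFinD lee_fin -mulrBr normrM -/(Delta k y).
  have /andP[d0 d1] := Delta01 k y.
  (* On [Z] the factor [Delta] is at most 1 and the tail term dominates; elsewhere |g| is at most
     [M]. *)
  have [Zy|Zy] := pselect (Z y).
    rewrite [\1_Z y]indicE mem_set// mulr1.
    apply: (@le_trans _ _ `|g y|); first by rewrite ler_piMr.
    by rewrite lerDr mulr_ge0//; have := ND0 y; rewrite lee_fin.
  move/contrapT: Zy => [Ny gy].
  rewrite [\1_(norm_ball _) y]indicE mem_set// mul1r.
  apply: (@le_trans _ _ (M%:R * Delta k y)); first by rewrite ler_wpM2r.
  by rewrite lerDl; have := gZ0 y; rewrite lee_fin.
apply/cvgrPdist_le => e e0.
have e20 : 0 < e / 2 by rewrite divr_gt0.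
have tail0 := integral_tail_cvg0 ig.
have [M Me] : exists M, (tail M <= (e / 2)%:E)%E.
  have /fine_cvgP[tfin /cvgrPdist_le/(_ _ e20)] := tail0.
  move=> tle; have [N _ hN] := filterI tfin tle; exists N.
  have [/= t1] := hN N (leqnn N); rewrite sub0r normrN => t2.
  by rewrite -(@fineK _ (tail N))// lee_fin (le_trans _ t2)// ler_norm.
have c0 : 0 < e / 2 / (M%:R + 1) by rewrite divr_gt0// ltr_wpDl.
have /fine_cvgP[dfin /cvgrPdist_le/(_ _ c0) dle] := DeltaK M%:R.
near=> k; rewrite distrC -lee_fin; apply: (le_trans (key k M)).
have dk : (\int[lebesgue_row n]_(y in norm_ball M%:R) (Delta k y)%:E)%E \is a fin_num.
  by near: k; exact: dfin.
rewrite -(fineK dk) -EFinM.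
have dk2 : fine (\int[lebesgue_row n]_(y in norm_ball M%:R) (Delta k y)%:E)%E <= e / 2 / (M%:R + 1).
  apply: (le_trans (ler_norm _)); rewrite -normrN -sub0r; near: k; exact: dle.
apply: (@le_trans _ _ ((e / 2)%:E + (e / 2)%:E)%E); last by rewrite -EFinD lee_fin -splitr.
apply: leeD => //; rewrite lee_fin.
apply: (@le_trans _ _ (M%:R * (e / 2 / (M%:R + 1)))); first by rewrite ler_wpM2l.
by rewrite mulrCA ler_piMr ?(ltW e20)// ler_pdivrMr ?ltr_wpDl// mul1r lerDl.
Unshelve. all: by end_near. Qed.

End L1loc_convergence.

(** * Blow-ups of the gradient *)

Section gradient.
Context {R : realType} {n : nat} (alpha : R).
Implicit Types (E F : set 'rV[R]_n) (x y w : 'rV[R]_n).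

Lemma vtotal_variation_cst0 (B : set 'rV[R]_n) :
  (vtotal_variation (fun=> (0 : 'rV[R]_n)%R) B <= 0)%E.
Proof.
apply: ge_ereal_sup => _ [P _ <-].
by rewrite eseries0// => k _ _; rewrite enorm0.
Qed.

Lemma vtotal_variation_set0 (D : set 'rV[R]_n -> 'rV[R]_n) : D set0 = 0 ->
  vtotal_variation D set0 = 0%E.
Proof.
move=> D0; apply/eqP; rewrite eq_le; apply/andP; split.
  apply: ge_ereal_sup => _ [P [_ _ P0] <-].
  rewrite eseries0// => k _ _; rewrite (_ : P k = set0) ?D0 ?enorm0//.
  by rewrite -subset0 -P0; exact: bigcup_sup.
apply: ereal_sup_ubound; exists (fun=> set0).
  split; first by move=> k; split => //; exact: bounded_set0.
    by apply/trivIsetP => i j _ _ _; rewrite setI0.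
  by rewrite bigcup0.
by rewrite eseries0// => k _ _; rewrite D0 enorm0.
Qed.

Lemma frac_gradient_default E :
  is_frac_gradient alpha E (frac_gradient alpha E) \/
  frac_gradient alpha E = fun=> 0.
Proof.
have [[D hD]|nD] := pselect (exists D, is_frac_gradient alpha E D).
  by left; apply: (@xgetPex _ _ [set D | is_frac_gradient alpha E D]); exists D.
by right; apply: xgetPN => D hD; apply: nD; exists D.
Qed.

Lemma frac_gradient_spec E x : vmeasure_support (frac_gradient alpha E) x ->
  is_frac_gradient alpha E (frac_gradient alpha E).
Proof.
case: (frac_gradient_default E) => // -> /(_ 1 ltr01).
by rewrite ltNge vtotal_variation_cst0.
Qed.

Lemma frac_gradient_set0 E : frac_gradient alpha E set0 = 0.
Proof. by case: (frac_gradient_default E) => [[/radon0]|->]. Qed.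

Lemma lebesgue_measurable_blow_up E x r : 0 < r -> lebesgue_measurable E ->
  lebesgue_measurable (blow_up E x r).
Proof.
move=> r0 /lebesgue_measurable_core[A /(borel_core_blow_up x r0)].
by move=> [mA [B [mB AE EB BA]]]; exists (blow_up A x r), B.
Qed.

Lemma affine_eball x r s y : 0 < r ->
  eball 0 s (affine r x y) <-> eball x (r * s) y.
Proof.
move=> r0; rewrite /eball /affine /= subr0 enormZ ger0_norm ?invr_ge0 ?(ltW r0)//.
by rewrite ltr_pdivrMl.
Qed.

Lemma normr_Rintegral_le E (g : 'rV[R]_n -> R) : lebesgue_measurable E ->
  (lebesgue_row n).-integrable setT (EFin \o g) ->
  `|\int[lebesgue_row n]_(y in E) g y| <= \int[lebesgue_row n]_y `|g y|.
Proof.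
move=> /lebesgue_measurable_core[A EA] ig.
have mg : measurable_fun setT g by apply/measurable_EFinP; exact: measurable_int ig.
rewrite (Rintegral_core EA mg); have [mA _] := EA.
have igA : (lebesgue_row n).-integrable A (EFin \o g).
  by apply: integrableS ig.
apply: (le_trans (le_normr_Rintegral mA igA)).
rewrite /Rintegral; apply: fine_le.
- by apply: integrable_fin_num => //; exact: (integrable_norm igA).
- by apply: integrable_fin_num => //; exact: (integrable_norm ig).
apply: ge0_subset_integral => //.
by apply/measurable_EFinP; exact: measurableT_comp.
Qed.

End gradient.

Section blow_up_gradient.
Context {R : realType} {n : nat} (alpha : R).
Hypothesis halpha : 0 < alpha < 1.
Variables (E : set 'rV[R]_n) (x : 'rV[R]_n) (D : set 'rV[R]_n -> 'rV[R]_n).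
Hypothesis mE : lebesgue_measurable E.
Hypothesis hD : is_frac_gradient alpha E D.

Let rD : vector_radon D. Proof. by case: hD. Qed.

Local Notation T r := (fine (vtotal_variation D (eball x r))).

Let mB r : measurable (eball x r). Proof. exact: measurable_eball. Qed.
Let bB r : bounded_set (eball x r). Proof. exact: bounded_eball. Qed.

Lemma variation_ball_ge0 r : 0 <= T r.
Proof.
apply: le_trans (enorm_variation rD (mB r) (mB r) (bB r) (@subset_refl _ _)).
exact: enorm_ge0.
Qed.

(** Transfers statements about [E] near [x] to its blow-ups: the Gauss-Green identity is tested with
    a rescaled field. *)
Lemma vector_integral_affine phi r : 0 < r -> test_field setT phi ->
  vector_integral D (fun y => phi (affine r x y)) =
  - (r `^ (n%:R - alpha) *
    \int[lebesgue_row n]_(y in blow_up E x r) frac_div alpha phi y).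
Proof.
move=> r0 tphi; rewrite -(Rintegral_frac_div_affine halpha x r0 mE tphi).
have [_ _ ->] := hD; first by rewrite opprK.
have [s s0 phis] := test_field_support tphi.
have [sphi cK _] := tphi.
have [s' s'0 Ks] := bounded_sub_eball (compact_bounded cK).
have : test_field (eball x (r * s')) (fun y => phi (affine r x y)).
  apply: (@test_field_affine _ _ _ _ _ (eball 0 s')) => //.
  by move=> y /affine_eball; apply.
by move=> [? ? _]; split.
Qed.

Variable nu : 'rV[R]_n.
Hypothesis nu1 : enorm nu = 1.
Hypothesis Dnu : forall e, 0 < e -> exists2 r0, 0 < r0 &
  forall r, 0 < r < r0 -> (1 - e) * T r <= edot nu (D (eball x r)).

(** A bump on the ball of radius 2 r is split as c0 f1 + f2, with f1 equal to 1 on the ball of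
    radius [r]. Every superlevel set of f1 below level 1 is a centered ball containing that ball, so
    c0 f1 contributes at least half of c0 |D|(B_r); the part f2 contributes nonnegatively. The
    scaling identity bounds the total from above. *)
Lemma variation_ball_density : exists C r1, [/\ 0 <= C, 0 < r1 &
  forall r, 0 < r < r1 -> T r <= C * r `^ (n%:R - alpha)].
Proof.
have h20 : 0 < 2^-1 :> R by [].
have [r0 r00 Dr0] := Dnu h20.
(* The value of the unit bump at distance 1/2 from its center, since 3 / 4 = 1 - (1/2)^2. *)
pose c0 : R := flat 1 (3 / 4) / flat 1 1.
have c00 : 0 < c0 by rewrite divr_gt0 ?flat1_gt0// divr_gt0.
pose phi (y : 'rV[R]_n) := bumpn 0 1 1 y *: nu.
have tphi : test_field setT phi by exact: test_field_bumpn.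
pose I := \int[lebesgue_row n]_y `|frac_div alpha phi y|.
have I0 : 0 <= I by apply: Rintegral_ge0 => y _.
(* Solves c0 / 2 * |D|(B_r) <= (2 r)^(n - alpha) I for the variation; halving [r0] keeps the radius
   2 r in the aligned range. *)
exists (2 / c0 * I * 2 `^ (n%:R - alpha)), (r0 / 2); split.
- by rewrite !mulr_ge0 ?powR_ge0// invr_ge0 ltW.
- by rewrite divr_gt0.
move=> r /andP[rgt0 rr0].
pose s := 2 * r.
have s0 : 0 < s by rewrite mulr_gt0.
have sr0 : s < r0 by rewrite /s mulrC -ltr_pdivlMr.
pose f y := bump 0 1 (affine s x y).
have f01 y : 0 <= f y <= 1 by rewrite bump_ge0// bump_le1.
have hf : bounded_support (eball x s) f.
  split.
  - apply: (measurableT_comp _ (measurable_affine s x)).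
    apply: continuous_measurable_row; apply: bump_algebra_continuous.
    exact: bump_algebra_bump.
  - by exists 1 => y; have /andP[? ?] := f01 y; rewrite ger0_norm.
  - move=> y yx; apply: bump_out => // /(affine_eball _ _ _ s0).1.
    by rewrite mulr1.
(* the superlevel sets of f are balls centered at x, where D is almost aligned
   with nu *)
have level t : 0 <= t < 1 -> exists2 s', 0 < s' <= s &
    [set y | t < f y] = eball x s'.
  move=> /andP[t0 t1]; have [t0'|t0'] := eqVneq t 0.
    exists s; first by rewrite s0 lexx.
    rewrite t0'; apply/seteqP; split => y /=.
      move=> fy; apply: contrapT => xy.
      by have [_ _ h] := hf; rewrite h// ltxx in fy.
    by rewrite -{1}(mulr1 s) => /(affine_eball _ _ _ s0).2; exact: bump_gt0.
  have tt : 0 < t < 1 by rewrite t1 lt_neqAle eq_sym t0' t0.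
  have [rho /andP[rho0 rho1] E'] := @bump_level _ n 0 1 t ltr01 tt.
  exists (s * rho); first by rewrite mulr_gt0//= ler_piMr// ltW.
  apply/seteqP; split => y /=.
    move=> fy; apply: (affine_eball _ _ _ s0).1.
    by have : [set y | t < bump 0 1 y] (affine s x y) by []; rewrite E'.
  by move=> /(affine_eball _ _ _ s0).2; rewrite -E'.
have levelD t : 0 <= t < 1 -> 0 <= edot nu (D [set y | t < f y]).
  move=> /level[s' /andP[s'0 s's] ->].
  apply: le_trans (Dr0 s' _); last by rewrite s'0 (le_lt_trans s's).
  by rewrite mulr_ge0 ?variation_ball_ge0//; lra.
have flow y : eball x r y -> c0 <= f y.
  rewrite (_ : r = s * 2^-1); last by rewrite /s; field.
  move=> /(affine_eball _ _ _ s0).2; rewrite /eball /= => h.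
  rewrite /f /bump expr1n; apply: ler_wpM2r.
    by rewrite invr_ge0 ltW// flat1_gt0.
  apply: flat1_homo; rewrite -sqr_enorm.
  have : enorm (affine s x y - 0) ^+ 2 <= 2^-1 ^+ 2.
    by rewrite ler_sqr ?nnegrE ?enorm_ge0 ?invr_ge0// ltW.
  lra.
pose f1 y := c0^-1 * Num.min (f y) c0.
pose f2 y := Num.max (f y - c0) 0.
have fE y : f y = c0 * f1 y + f2 y.
  rewrite /f1 /f2 mulrA mulfV ?gt_eqF// mul1r.
  rewrite /Num.min /Num.max; case: ltP => h; case: ltP => h'; lra.
have [mf _ fout] := hf.
have hf1 : bounded_support (eball x s) f1.
  apply: bounded_supportZ; split.
  - exact: measurable_minr.
  - exists 1 => y; have /andP[f0 f1'] := f01 y.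
    rewrite ger0_norm ?le_min ?f0 ?(ltW c00)//.
    by rewrite ge_min f1'.
  - by move=> y /fout fy /=; rewrite fy; apply/min_idPl; exact: ltW.
have hf2 : bounded_support (eball x s) f2.
  split.
  - by apply: measurable_maxr => //; exact: measurable_funB.
  - exists 1 => y; have /andP[f0 f1'] := f01 y.
    rewrite ger0_norm ?le_max ?lexx ?orbT// ge_max ler01 andbT; lra.
  - by move=> y /fout fy; rewrite /f2 fy; apply/max_idPr; lra.
have f1_01 y : 0 <= f1 y <= 1.
  have /andP[f0 f1'] := f01 y.
  rewrite mulr_ge0 ?invr_ge0 ?le_min ?f0 ?(ltW c00)//=.
  by rewrite ler_pdivrMl// mulr1 ge_min lexx orbT.
have f2_01 y : 0 <= f2 y <= 1.
  have /andP[f0 f1'] := f01 y.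
  rewrite le_max lexx orbT ge_max ler01 andbT/=; lra.
have L1 : 2^-1 * T r <= vector_integral D (fun y => f1 y *: nu).
  apply: (layer_cake_ge rD (mB s) (bB s) hf1) => // t /andP[t0 t1].
  have ct : 0 <= c0 * t < 1.
    rewrite mulr_ge0 ?(ltW c00)//= (lt_le_trans (_ : _ < c0))//.
      by rewrite gtr_pMr.
    rewrite ler_pdivrMr ?flat1_gt0// mul1r; apply: flat1_homo; lra.
  have -> : [set y | t < f1 y] = [set y | c0 * t < f y].
    apply/seteqP; split => y /=; rewrite /f1 ltr_pdivlMl// lt_min.
      by move=> /andP[].
    by move=> ->/=; rewrite gtr_pMr.
  have [s' /andP[s'0 s's] Es'] := level _ ct.
  rewrite Es'; apply: le_trans (Dr0 s' _); last by rewrite s'0 (le_lt_trans s's).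
  rewrite (_ : 1 - 2^-1 = 2^-1); last by lra.
  rewrite ler_wpM2l ?(ltW h20)//; apply: (variation_mono rD) => //.
  rewrite -Es' => y /flow; apply: lt_le_trans.
  by rewrite gtr_pMr.
have L2 : 0 <= vector_integral D (fun y => f2 y *: nu).
  apply: (layer_cake_ge rD (mB s) (bB s) hf2) => // t /andP[t0 t1].
  have -> : [set y | t < f2 y] = [set y | t + c0 < f y].
    apply/seteqP; split => y /=; rewrite /f2 lt_max (ltNge t 0) t0 orbF ltrBrDr//.
  have [tc|tc] := ltP (t + c0) 1.
    by apply: levelD; rewrite tc addr_ge0// ltW.
  have -> : [set y | t + c0 < f y] = set0.
    apply/seteqP; split => // y /=; have /andP[_ f1'] := f01 y.
    by rewrite ltNge (le_trans f1' tc).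
  by rewrite (radon0 rD) edotC edot0l.
have Lf : c0 * (2^-1 * T r) <= vector_integral D (fun y => f y *: nu).
  rewrite (_ : (fun y => f y *: nu) = (fun y => (c0 * f1 y + f2 y) *: nu)); last first.
    by apply/funext => y; rewrite -fE.
  rewrite (vector_integralD rD (mB s) (bB s))//; last exact: bounded_supportZ.
  rewrite (vector_integralZ rD (mB s) (bB s))// -[leLHS]addr0 lerD//.
  by rewrite ler_wpM2l ?(ltW c00).
have Lup : vector_integral D (fun y => f y *: nu) <= s `^ (n%:R - alpha) * I.
  have := vector_integral_affine s0 tphi; rewrite /phi bumpn1 => ->.
  rewrite -mulrN ler_wpM2l ?powR_ge0//.
  apply: (le_trans (ler_norm _)); rewrite normrN.
  have := normr_Rintegral_le (lebesgue_measurable_blow_up x s0 mE)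
    (integrable_frac_div halpha tphi).
  by rewrite /I /phi bumpn1.
have := le_trans Lf Lup; clearbody c0; rewrite /s powRM ?ler0n ?(ltW rgt0)//.
rewrite mulrA -ler_pdivlMl ?mulr_gt0// => h; apply: (le_trans h).
rewrite le_eqVlt; apply/orP; left; apply/eqP.
by field; rewrite gt_eqF.
Qed.

Variables (F : set 'rV[R]_n) (r : nat -> R).
Hypothesis mF : lebesgue_measurable F.
Hypothesis r_gt0 : forall k, 0 < r k.
Hypothesis r_cvg0 : r @ \oo --> 0.
Hypothesis EF : cvg_L1loc (fun k => blow_up E x (r k)) F.

Lemma near_radius M r0 : 0 < M -> 0 < r0 ->
  \forall k \near \oo, 0 < M * r k < r0.
Proof.
move=> M0 r00; have e0 : 0 < r0 / M by rewrite divr_gt0.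
have /cvgrPdist_lt/(_ _ e0) := r_cvg0; apply: filterS => k.
rewrite sub0r normrN ger0_norm ?(ltW (r_gt0 k))// ltr_pdivlMr// mulrC => ->.
by rewrite mulr_gt0.
Qed.

Lemma blow_up_variation_bound : exists C, 0 <= C /\ forall M, 0 < M ->
  \forall k \near \oo, T (M * r k) <= C * M `^ (n%:R - alpha) * r k `^ (n%:R - alpha).
Proof.
have [C [r1 [C0 r10 hC]]] := variation_ball_density.
exists C; split=> // M M0; have := near_radius M0 r10.
apply: filterS => k /hC; rewrite powRM ?(ltW M0) ?(ltW (r_gt0 k))//.
by rewrite mulrA.
Qed.

Lemma cvg_blow_up_frac_div phi : test_field setT phi ->
  (fun k => \int[lebesgue_row n]_(y in blow_up E x (r k)) frac_div alpha phi y)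
    @ \oo --> \int[lebesgue_row n]_(y in F) frac_div alpha phi y.
Proof.
move=> tphi; apply: cvg_Rintegral_L1loc => //.
  by move=> k; exact: lebesgue_measurable_blow_up.
exact: integrable_frac_div.
Qed.

(** A test field on a ball of radius [M], rescaled to E, is admissible in the ball of radius M r_k.
    The density bound there has the factor r_k^(n - alpha), which cancels the one from scaling, so
    the bound depends on neither [k] nor the field. *)
Lemma loc_finite_frac_perimeter_limit : loc_finite_frac_perimeter alpha F.
Proof.
split=> // U oU bU; have [M M0 UM] := bounded_sub_eball bU.
have [C [C0 hC]] := blow_up_variation_bound.
apply: (@le_lt_trans _ _ (C * M `^ (n%:R - alpha))%:E); last by rewrite ltry.
apply: ge_ereal_sup => _ [phi [tphi phi1] <-]; rewrite lee_fin.
have tphiT : test_field setT phi by case: tphi => ? ? _; split.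
have cv := cvg_blow_up_frac_div tphiT.
rewrite -(cvg_lim (@Rhausdorff R) cv); apply: limr_le.
  by apply/cvg_ex; eexists; exact: cv.
have := hC M M0; apply: filterS => k Tk.
have rk0 := r_gt0 k; have pk0 : 0 < r k `^ (n%:R - alpha) by rewrite powR_gt0.
rewrite -(ler_pM2l pk0) [leRHS]mulrC.
rewrite -(Rintegral_frac_div_affine halpha x rk0 mE tphiT).
apply: le_trans Tk; rewrite -lee_fin (fineK (variation_fin rD (mB _) (bB _))).
have [_ hU _] := hD; rewrite (hU _ (@open_eball _ _ _ _)).
apply: ereal_sup_ubound; exists (fun y => phi (affine (r k) x y)) => //.
split; last exact: Lnorm_affine.
apply: (@test_field_affine _ _ _ _ _ U) => //.
by move=> y /= /UM /(affine_eball _ _ _ rk0).1; rewrite mulrC.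
Qed.

(** The superlevel sets of the rescaled bump are not centered at [x], but they lie in a centered
    ball, so the defect estimate [edot_radon_le] applies to each of them. *)
Lemma vector_integral_limit_le0 (DF : set 'rV[R]_n -> 'rV[R]_n) y rho j w :
  is_frac_gradient alpha F DF -> 0 < rho -> edot w nu <= 0 ->
  vector_integral DF (fun z => bumpn y rho j z *: w) <= 0.
Proof.
move=> [_ _ hDF] rho0 wnu.
have tphi : test_field setT (fun z => bumpn y rho j z *: w) by exact: test_field_bumpn.
rewrite -[leLHS]opprK -(hDF _ tphi).
have [M M0 UM] := bounded_sub_eball (bounded_eball y rho).
have [C [C0 hC]] := blow_up_variation_bound.
apply/ler_addgt0Pr => e' e'0; rewrite add0r.
(* [K - 1] multiplies e r_k^(n - alpha) in the final estimate; the added 1 makes [K] positive. *)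
pose K := enorm w * (2 * (C * M `^ (n%:R - alpha))) + 1.
have K0 : 0 < K.
  by rewrite ltr_wpDl// !mulr_ge0 ?enorm_ge0 ?powR_ge0.
pose e := e' / K; have e0 : 0 < e by rewrite divr_gt0.
have e20 : 0 < e ^+ 2 by rewrite exprn_gt0.
(* With alignment at precision e^2, the defect divided by 2 e is at most half of e times the
   variation, of the same order as the other error term. *)
have [r0 r00 Dr0] := Dnu e20.
have cv : (fun k => - \int[lebesgue_row n]_(z in blow_up E x (r k))
    frac_div alpha (fun z => bumpn y rho j z *: w) z) @ \oo -->
    - \int[lebesgue_row n]_(z in F) frac_div alpha (fun z => bumpn y rho j z *: w) z.
  by apply: cvgN; exact: cvg_blow_up_frac_div.
rewrite -(cvg_lim (@Rhausdorff R) cv); apply: limr_le.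
  by apply/cvg_ex; eexists; exact: cv.
near=> k.
have rk0 := r_gt0 k; have pk0 : 0 < r k `^ (n%:R - alpha) by rewrite powR_gt0.
rewrite -(ler_pM2l pk0) mulrN -(vector_integral_affine rk0 tphi).
have Mrk : 0 < M * r k < r0 by near: k; exact: near_radius.
have Tk : T (M * r k) <= C * M `^ (n%:R - alpha) * r k `^ (n%:R - alpha).
  by near: k; exact: hC.
have sub z : bumpn y rho j (affine (r k) x z) != 0 -> eball x (M * r k) z.
  move=> h; rewrite mulrC; apply/(affine_eball _ _ _ rk0); apply: UM.
  by apply: contrapT => h'; move: h; rewrite bumpn_out// eqxx.
have hf : bounded_support (eball x (M * r k)) (fun z => bumpn y rho j (affine (r k) x z)).
  have [mb [N hN] _] := bounded_support_bumpn y j rho0; split.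
  - exact: (measurableT_comp mb (measurable_affine _ _)).
  - by exists N.
  - by move=> z hz; apply/eqP; apply: contrapT => /negP /sub.
have T0 := variation_ball_ge0 (M * r k).
have Tnu := Dr0 _ Mrk.
have bd : vector_integral D (fun z => bumpn y rho j (affine (r k) x z) *: w) <=
    enorm w * (2 * e * T (M * r k)).
  apply: (layer_cake_le rD (mB _) (bB _) hf) => [z|t /andP[t0 t1]].
    exact: bumpn_ge0_le1.
  apply: (le_trans (edot_radon_le rD (mB _) (bB _) nu1 wnu e0 _ _)).
  - rewrite (_ : [set z | _] = (fun z => bumpn y rho j (affine (r k) x z)) @^-1` `]t, +oo[%classic).
      by rewrite -[X in measurable X]setTI; have [mf _ _] := hf; exact: mf.
    by apply/seteqP; split=> z /=; rewrite in_itv/= andbT.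
  - by move=> z /= tz; apply: sub; rewrite gt_eqF// (le_lt_trans t0).
  rewrite ler_wpM2l ?enorm_ge0//.
  have h : T (M * r k) - edot nu (D (eball x (M * r k))) <= e ^+ 2 * T (M * r k).
    by move: Tnu; rewrite mulrBl mul1r; lra.
  apply: (@le_trans _ _ (e * T (M * r k) + e ^+ 2 * T (M * r k) / (2 * e))).
    by rewrite lerD2l ler_wpM2r// invr_ge0 mulr_ge0// ltW.
  rewrite (_ : e ^+ 2 * _ / _ = e * T (M * r k) / 2); last by field; rewrite gt_eqF.
  have : 0 <= e * T (M * r k) by rewrite mulr_ge0// ltW.
  lra.
apply: (le_trans bd).
apply: (@le_trans _ _ (enorm w * (2 * e * (C * M `^ (n%:R - alpha) * r k `^ (n%:R - alpha))))).
  by rewrite ler_wpM2l ?enorm_ge0// ler_wpM2l// mulr_ge0// ltW.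
rewrite (_ : _ * _ = r k `^ (n%:R - alpha) * (e * (K - 1))); last by rewrite /K; ring.
rewrite ler_wpM2l ?(ltW pk0)// /e mulrAC ler_pdivrMr// ler_wpM2l ?(ltW e'0)//.
by rewrite lerBlDr lerDl.
Unshelve. all: by end_near. Qed.

(** The half-space inequality [H] for [- nu] gives the sign. For the component [u] of [v] orthogonal
    to [nu] it gives |u|^2 = u . v <= 0. *)
Lemma gradient_limit_parallel (DF : set 'rV[R]_n -> 'rV[R]_n) y rho :
  is_frac_gradient alpha F DF -> 0 < rho ->
  DF (eball y rho) = edot nu (DF (eball y rho)) *: nu /\
  0 <= edot nu (DF (eball y rho)).
Proof.
move=> hDF rho0; have [rDF _ _] := hDF; set v := DF _.
have mBy : measurable (eball y rho) by exact: measurable_eball.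
have H w : edot w nu <= 0 -> edot w v <= 0.
  move=> wnu.
  have h : (fun j => vector_integral DF (fun z => bumpn y rho j z *: w)) @ \oo -->
      edot w v.
    rewrite -(vector_integral_indic rDF mBy (bounded_eball y rho) w mBy (@subset_refl _ _)).
    apply: (vector_integral_cvg rDF mBy (bounded_eball y rho)).
    - by move=> j; exact: bounded_support_bumpn.
    - exact: bounded_support_indic.
    - move=> j z; have /andP[b0 b1] := bumpn_ge0_le1 y j z rho0.
      by rewrite ger0_norm.
    - by move=> z; exact: bumpn_cvg.
  rewrite -(cvg_lim (@Rhausdorff R) h); apply: limr_le.
    by apply/cvg_ex; eexists; exact: h.
  by apply: nearW => j; exact: vector_integral_limit_le0 hDF rho0 wnu.
have nunu : edot nu nu = 1 by rewrite -sqr_enorm nu1 expr1n.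
have c0 : 0 <= edot nu v.
  by have := H (- nu); rewrite !edotNl nunu !oppr_le0; apply; exact: ler01.
split => //; set c := edot nu v.
pose u := v - c *: nu.
have unu : edot u nu = 0 by rewrite /u edotBl edotZl nunu mulr1 edotC subrr.
have : edot u u <= 0.
  by rewrite {2}/u edotBr edotZr unu mulr0 subr0; apply: H; rewrite unu.
move=> uu; have /eqP : edot u u = 0 by apply/eqP; rewrite eq_le uu edot_ge0.
rewrite -sqr_enorm sqrf_eq0 => /eqP/enorm_eq0/eqP.
by rewrite subr_eq0 => /eqP.
Qed.

End blow_up_gradient.

(** * Reduced boundary and conclusion *)

Section reduced_boundary.
Context {R : realType} {n : nat} (alpha : R).
Implicit Types (E F : set 'rV[R]_n) (x y : 'rV[R]_n).

Lemma frac_quotient_edot E x : frac_reduced_boundary alpha E x ->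
  edot (frac_normal alpha E x) (frac_quotient alpha E x r) @[r --> 0^'+] --> (1 : R).
Proof.
move=> [_ cv nu1]; rewrite -[1](expr1n _ 2) -nu1 sqr_enorm.
apply: edot_cvg; first exact: cvg_cst.
exact: cv.
Qed.

(** Since |nu| = 1, the component of the quotient along [nu] tends to 1; multiplying by the
    variation, positive at points of the support, gives the estimate. *)
Lemma frac_quotient_aligned E x : frac_reduced_boundary alpha E x ->
  forall e, 0 < e -> exists2 r0, 0 < r0 & forall r, 0 < r < r0 ->
    (1 - e) * fine (vtotal_variation (frac_gradient alpha E) (eball x r)) <=
    edot (frac_normal alpha E x) (frac_gradient alpha E (eball x r)).
Proof.
move=> hx e e0; have [xE _ _] := hx.
have [rD _ _] := frac_gradient_spec xE.
have /cvgrPdist_lt/(_ _ e0) := frac_quotient_edot hx.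
move=> [r0 /= r00 h]; exists r0 => // r /andP[rgt0 rr0].
have T0 : 0 < fine (vtotal_variation (frac_gradient alpha E) (eball x r)).
  rewrite -lte_fin (fineK (variation_fin rD (measurable_eball _ _) (bounded_eball _ _))).
  exact: xE.
have := h r _ rgt0; rewrite /= sub0r normrN ger0_norm ?(ltW rgt0)// => /(_ rr0).
rewrite /frac_quotient edotZr => /(le_lt_trans (ler_norm _)).
rewrite ltrBlDr -ltrBlDl ltr_pdivlMl// => /ltW; by rewrite mulrC.
Qed.

End reduced_boundary.

Theorem proposition5p9 (R : realType) (n : nat) (hn : (1 <= n)%N)
  (alpha : R) (halpha : 0 < alpha < 1)
  (E : set 'rV[R]_n) (hE : loc_finite_frac_perimeter alpha E)
  (x : 'rV[R]_n) (hx : frac_reduced_boundary alpha E x)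
  (F : set 'rV[R]_n) (hF : tangent_sets E x F) :
  loc_finite_frac_perimeter alpha F /\
  {ae vtotal_variation (frac_gradient alpha F), forall y,
    frac_reduced_boundary alpha F y ->
    frac_normal alpha F y = frac_normal alpha E x}.
Proof.
have [xE _ nu1] := hx; have [mE _] := hE.
have hD := frac_gradient_spec xE.
have Dnu := frac_quotient_aligned hx.
have [mF [r [r_gt0 r0 EF]]] := hF.
split; first exact: (loc_finite_frac_perimeter_limit halpha mE hD Dnu mF r_gt0 r0 EF).
(* The empty set has zero variation whether the gradient is genuine or the default. *)
exists set0; split=> //.
  by apply: vtotal_variation_set0; exact: frac_gradient_set0.
move=> y /= []; move=> [yF cvF nuF1].
have hDF := frac_gradient_spec yF.
set nu := frac_normal alpha E x in nu1 Dnu *.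
set nuF := frac_normal alpha F y in nuF1 *.
have cvnuF : frac_quotient alpha F y @ 0^'+ --> nuF by exact: cvF.
clearbody nu nuF.
(* Dividing by the variation preserves nonnegative multiples of [nu], and these form a closed set,
   so the limit is one too. *)
have par rho : 0 < rho -> 0 <= edot nu (frac_quotient alpha F y rho) /\
    frac_quotient alpha F y rho = edot nu (frac_quotient alpha F y rho) *: nu.
  move=> rho0; rewrite /frac_quotient edotZr.
  have [eD D0] := gradient_limit_parallel halpha mE hD nu1 Dnu mF r_gt0 r0 EF y hDF rho0.
  rewrite {2}eD scalerA; split => //; rewrite mulr_ge0// invr_ge0.
  by rewrite fine_ge0// ltW// yF.
have cva : edot nu (frac_quotient alpha F y rho) @[rho --> 0^'+] --> edot nu nuF.
  by apply: edot_cvg; [exact: cvg_cst|exact: cvnuF].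
have a0 : 0 <= edot nu nuF.
  rewrite -(cvg_lim (@Rhausdorff R) cva); apply: limr_ge.
    by apply/cvg_ex; eexists; exact: cva.
  near=> rho; have [] := par rho; by [near: rho; exact: nbhs_right_gt|].
have nuFE : nuF = edot nu nuF *: nu.
  apply/rowP => i; rewrite mxE.
  have c1 : frac_quotient alpha F y rho ord0 i @[rho --> 0^'+] --> nuF ord0 i.
    exact: coord_cvg.
  have c2 : frac_quotient alpha F y rho ord0 i @[rho --> 0^'+] --> edot nu nuF * nu ord0 i.
    have eQ : \forall rho \near 0^'+, edot nu (frac_quotient alpha F y rho) * nu ord0 i =
        frac_quotient alpha F y rho ord0 i.
      near=> rho; have [|_ {2}->] := par rho; first by near: rho; exact: nbhs_right_gt.
      by rewrite mxE.
    apply: cvg_trans (near_eq_cvg eQ) _.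
    by apply: cvgM; [exact: cva|exact: cvg_cst].
  exact: (cvg_unique _ c1 c2).
(* Both vectors have norm 1 and the factor is nonnegative, hence equal to 1. *)
by move: nuF1; rewrite nuFE enormZ nu1 mulr1 ger0_norm// => ->; rewrite scale1r.
Unshelve. all: by end_near. Qed.
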